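(* Fix $p\ge 1$ and let $n\to\infty$. Let $F=F_n$ denote the penalized log-likelihood $F(\nu)=\ell_n(\nu\mid X)-n\,p_{\lambda_n}(\nu)$ on the DAG space $\mathcal{D}\subset\mathbb{R}^{p^2}$. If there exists $\nu_0\in\mathcal{E}_0$ with $b_n(\nu_0)\to 0$, then there is a local maximizer $\widehat{\nu}_n$ of $F$ (over $\mathcal{D}$) such that $$\|\widehat{\nu}_n-\nu_0\|=O_P\big(n^{-1/2}+a_n(\nu_0)\big).$$
   Context: Data: $X=[x_1|\cdots|x_p]\in\mathbb{R}^{n\times p}$ has $n$ i.i.d. rows from $\mathcal{N}(0,\Sigma_0)$, with $\Sigma_0\in\mathbb{R}^{p\times p}$ positive definite; $\Theta_0:=\Sigma_0^{-1}$. Parameter space: a matrix $\Phi=(\phi_{ij})\in\mathbb{R}^{p\times p}$ is called a DAG if the directed graph on $\{1,\dots,p\}$ with an edge $i\to j$ iff $\phi_{ij}\neq 0$ has no directed cycles (in particular $\phi_{jj}=0$). For a DAG $\Phi=[\phi_1|\cdots|\phi_p]$ and $R=\mathrm{diag}(\rho_1,\dots,\rho_p)$ with all $\rho_j>0$, put $U=(u_{ij})=R+\Phi$ and $\nu=\nu(\Phi,R)=\mathrm{vec}(U)\in\mathbb{R}^{p^2}$. The set of all such $\nu$ is $\mathcal{D}\subset\mathbb{R}^{p^2}$, with the subspace topology; elements of $\mathcal D$ are identified with pairs $(\Phi,R)$. Define $\Theta(\nu)=\Theta(\Phi,R)=(R-\Phi)(R-\Phi)^T$ and $\mathcal{E}_0=\{\nu\in\mathcal{D}:\Theta(\nu)=\Theta_0\}$.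 Objective: the log-likelihood is $\ell_n(\nu\mid X)=\sum_{j=1}^p\big[n\log\rho_j-\tfrac12\|\rho_jx_j-X\phi_j\|^2\big]$. For each $\lambda$, $p_\lambda:[0,\infty)\to\mathbb{R}$ is a nonnegative, nondecreasing penalty function (with $p_\lambda'$, $p_\lambda''$ existing wherever they are used), $(\lambda_n)$ is a sequence of regularization parameters, and $p_\lambda(\nu)=\sum_{i\ne j}p_\lambda(|u_{ij}|)$. For $\nu_0\in\mathcal{E}_0$ corresponding to $(\Phi_0,R_0)$ with $\Phi_0=(\phi^0_{ij})$: $a_n(\nu_0)=\max\{|p_{\lambda_n}'(|\phi^0_{ij}|)|:\phi^0_{ij}\ne0\}$ and $b_n(\nu_0)=\max\{|p_{\lambda_n}''(|\phi^0_{ij}|)|:\phi^0_{ij}\ne0\}$. $\|\cdot\|$ is the Euclidean norm.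
   Formalization: Added: the penalty is continuous on (0,∞); near each nonzero |φ⁰_ij|, p'_{λ_n} and p''_{λ_n} exist on a common neighbourhood for large n and p''_{λ_n} is equicontinuous there. The claim fails otherwise. ν̂_n is a local maximizer with probability tending to one. *)

(* Defs.v *)
From HB Require Import structures.
From mathcomp Require Import all_boot all_order all_algebra.
From mathcomp Require Import all_classical all_reals all_analysis.

Set Implicit Arguments.
Unset Strict Implicit.
Unset Printing Implicit Defensive.

Import Order.TTheory GRing.Theory Num.Theory.
Import numFieldNormedType.Exports.

Local Open Scope classical_set_scope.
Local Open Scope ring_scope.

(* The library norm on matrices is the sup norm. *)
Definition enorm (R : realType) (m n : nat) (A : 'M[R]_(m, n)) : R :=
  Num.sqrt (\sum_i \sum_j A i j ^+ 2).

Definition posdef (R : realType) (p : nat) (S : 'M[R]_p) : Prop :=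
  S^T = S /\ forall v : 'rV[R]_p, v != 0 -> 0 < (v *m S *m v^T) 0 0.

(* [vec] stacks the columns ([mxvec] concatenates the rows). *)
Definition vec (R : realType) (p : nat) (U : 'M[R]_p) : 'rV[R]_(p * p) :=
  mxvec U^T.

Definition unvec (R : realType) (p : nat) (nu : 'rV[R]_(p * p)) : 'M[R]_p :=
  (vec_mx nu)^T.

(* No directed cycle in the graph with an edge i -> j iff Phi i j != 0;
   one-vertex cycles, i.e. self-loops, are included in [cycle]. *)
Definition is_dag (R : realType) (p : nat) (Phi : 'M[R]_p) : Prop :=
  forall c : seq 'I_p, cycle (fun i j => Phi i j != 0) c -> c = [::].

Definition nu_of (R : realType) (p : nat) (Phi : 'M[R]_p) (rho : 'rV[R]_p) :
    'rV[R]_(p * p) :=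
  vec (diag_mx rho + Phi).

Definition dag_space (R : realType) (p : nat) : set 'rV[R]_(p * p) :=
  [set nu | exists (Phi : 'M[R]_p) (rho : 'rV[R]_p),
      [/\ is_dag Phi, forall j, 0 < rho 0 j
        & nu = nu_of Phi rho]].

(* The pair (Phi, R) identified with nu, where R = diag_mx (rho_of nu);
   see [nu_ofK]. *)
Definition rho_of (R : realType) (p : nat) (nu : 'rV[R]_(p * p)) : 'rV[R]_p :=
  \row_j unvec nu j j.

Definition Phi_of (R : realType) (p : nat) (nu : 'rV[R]_(p * p)) : 'M[R]_p :=
  \matrix_(i, j) (if i == j then 0 else unvec nu i j).

Lemma nu_ofK (R : realType) (p : nat) (Phi : 'M[R]_p) (rho : 'rV[R]_p) :
  is_dag Phi ->
  Phi_of (nu_of Phi rho) = Phi /\ rho_of (nu_of Phi rho) = rho.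
Proof.
move=> dagP; have d0 i : Phi i i = 0.
  apply/eqP; apply: contraT => Pii.
  by have := dagP [:: i]; rewrite /= Pii => /(_ isT).
have U : unvec (nu_of Phi rho) = diag_mx rho + Phi.
  by rewrite /unvec /nu_of /vec mxvecK trmxK.
split; first (apply/matrixP => i j; rewrite mxE U !mxE).
  by case: eqP => [<-|_]; rewrite ?d0 // mulr0n add0r.
by apply/rowP => j; rewrite mxE U !mxE eqxx mulr1n d0 addr0.
Qed.

Definition Theta (R : realType) (p : nat) (nu : 'rV[R]_(p * p)) : 'M[R]_p :=
  (diag_mx (rho_of nu) - Phi_of nu) *m (diag_mx (rho_of nu) - Phi_of nu)^T.

Definition equiv_dags (R : realType) (p : nat) (Theta0 : 'M[R]_p) :
    set 'rV[R]_(p * p) :=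
  [set nu | dag_space nu /\ Theta nu = Theta0].

Definition loglik (R : realType) (n p : nat) (X : 'M[R]_(n, p))
    (nu : 'rV[R]_(p * p)) : R :=
  \sum_j (n%:R * ln (rho_of nu 0 j)
    - 2^-1 * enorm (rho_of nu 0 j *: col j X - X *m col j (Phi_of nu)) ^+ 2).

Definition total_penalty (R : realType) (p : nat) (q : R -> R)
    (nu : 'rV[R]_(p * p)) : R :=
  \sum_i \sum_(j | i != j) q `|unvec nu i j|.

Definition penalized_loglik (R : realType) (n p : nat) (q : R -> R)
    (X : 'M[R]_(n, p)) (nu : 'rV[R]_(p * p)) : R :=
  loglik X nu - n%:R * total_penalty q nu.

(* A penalty is a function on [0, +oo[; its values on negative reals are
   irrelevant.  A jump at 0 is allowed. *)
Definition is_penalty (R : realType) (q : R -> R) : Prop :=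
  [/\ forall t, 0 <= t -> 0 <= q t,
      forall s t, 0 <= s -> s <= t -> q s <= q t
    & forall t, 0 < t -> {for t, continuous q}].

(* The q n have two derivatives on a common neighbourhood of t0 for large n,
   and their second derivatives are (eventually) equicontinuous at t0. *)
Definition equi_C2_at (R : realType) (q : nat -> R -> R) (t0 : R) : Prop :=
  forall eps : R, 0 < eps -> \forall n \near \oo & t \near t0,
    [/\ derivable (q n) t 1, derivable (q n)^`()%classic t 1
      & `|(q n)^`(2)%classic t - (q n)^`(2)%classic t0| <= eps].

(* Maxima over an empty index set are 0. *)
Definition a_seq (R : realType) (p : nat) (q : nat -> R -> R)
    (nu0 : 'rV[R]_(p * p)) (n : nat) : R :=
  \big[Num.max/0]_(ij : 'I_p * 'I_p | Phi_of nu0 ij.1 ij.2 != 0)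
    `|(q n)^`()%classic `|Phi_of nu0 ij.1 ij.2| |.

Definition b_seq (R : realType) (p : nat) (q : nat -> R -> R)
    (nu0 : 'rV[R]_(p * p)) (n : nat) : R :=
  \big[Num.max/0]_(ij : 'I_p * 'I_p | Phi_of nu0 ij.1 ij.2 != 0)
    `|(q n)^`(2)%classic `|Phi_of nu0 ij.1 ij.2| |.

Definition borel (R : realType) (p : nat) : set (set 'rV[R]_p) :=
  <<s [set A : set 'rV[R]_p | open A] >>.

(* Y ~ N(0, S), S positive definite: Y is a random vector all of whose
   nontrivial linear combinations a . Y are N(0, a S a^T).  The second argument
   of [normal_prob] is the standard deviation. *)
Definition gaussian_vector (R : realType) (d : measure_display)
    (T : measurableType d) (P : probability T R) (p : nat)
    (Y : T -> 'rV[R]_p) (S : 'M[R]_p) : Prop :=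
  (forall B, borel B -> measurable (Y @^-1` B)) /\
  forall a : 'rV[R]_p, a != 0 -> forall B : set R, measurable B ->
    P [set w | B ((Y w *m a^T) 0 0)] =
    normal_prob 0 (Num.sqrt ((a *m S *m a^T) 0 0)) B.

(* Taking some of the B i to be the whole space gives the product rule for
   subfamilies. *)
Definition independent_rows (R : realType) (d : measure_display)
    (T : measurableType d) (P : probability T R) (n p : nat)
    (X : T -> 'M[R]_(n, p)) : Prop :=
  forall B : 'I_n -> set 'rV[R]_p, (forall i, borel (B i)) ->
    P [set w | forall i, B i (row i (X w))] =
    (\prod_(i < n) P [set w | B i (row i (X w))])%E.

Definition gaussian_sample (R : realType) (d : measure_display)
    (T : measurableType d) (P : probability T R) (n p : nat)
    (X : T -> 'M[R]_(n, p)) (S : 'M[R]_p) : Prop :=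
  (forall i, gaussian_vector P (fun w => row i (X w)) S) /\
  independent_rows P X.

Definition local_maximizer (R : realType) (m : nat) (D : set 'rV[R]_m)
    (f : 'rV[R]_m -> R) (x : 'rV[R]_m) : Prop :=
  D x /\ \forall y \near within D (nbhs x), f y <= f x.

(* Inner probability at least c; it is P E >= c when E is measurable. *)
Definition inner_prob_ge (R : realType) (d : measure_display)
    (T : measurableType d) (P : probability T R) (E : set T) (c : R) : Prop :=
  exists A : set T, [/\ measurable A, A `<=` E & (c%:E <= P A)%E].

Definition whp (R : realType) (d : measure_display) (T : measurableType d)
    (P : probability T R) (E : nat -> set T) : Prop :=
  forall eps : R, 0 < eps ->
    \forall n \near \oo, inner_prob_ge P (E n) (1 - eps).

Definition Op_bounded (R : realType) (d : measure_display) (T : measurableType d)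
    (P : probability T R) (Y : nat -> T -> R) (r : nat -> R) : Prop :=
  forall eps : R, 0 < eps -> exists C : R,
    \forall n \near \oo,
      inner_prob_ge P [set w | `|Y n w| <= C * r n] (1 - eps).

(* Main.v *)
(** Let S = X^T X / n and B = R - Phi. Then l_n(nu) = n L(S, nu) with
    L(S, nu) = sum_j ln rho_j - tr (B^T S B) / 2.

    The population function L(Sigma0, .) has zero derivative at nu0 along every
    DAG direction: Sigma0 B0 is the inverse transpose of B0, hence triangular in
    the opposite order, with diagonal 1 / rho0_j. Near nu0 the support of a DAG
    contains that of Phi0, so both share a topological order. Together with
    ln x <= x - 1 and the coercivity of tr (H^T S H) this gives, when the entries
    of S - Sigma0 are at most d,
      L(S, nu) <= L(S, nu0) + K d |nu - nu0| - lm |nu - nu0|^2.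
    As p' at nu0 is bounded by a_n and p'' is small near nu0, with d of order
    n^(-1/2) the penalized objective on the sphere of radius
    r = C (n^(-1/2) + a_n) is at most its value at nu0, so its maximum over the
    compact set of DAGs in the ball yields a local maximizer.

    When r is not small (a_n need not tend to 0) the global maximizer is used:
    the penalty is least at Phi = 0, so comparison with (Phi, R) = (0, 1) bounds
    the maximizers independently of the penalty, and r is bounded below.

    The estimate S - Sigma0 = O_P(n^(-1/2)) comes from a Chernoff bound for
    sums of squares of N(0, s^2) variables, at the parameters
    theta = n^(-1/2) and - n^(-1/2), applied to the marginals along
    e_j + e_k. *)

Require Import Defs.
From HB Require Import structures.
From mathcomp Require Import all_boot all_order all_algebra.
From mathcomp Require Import all_classical all_reals all_analysis.
From mathcomp Require Import measurable_realfun ring lra.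

Set Implicit Arguments.
Unset Strict Implicit.
Unset Printing Implicit Defensive.

Import Order.TTheory GRing.Theory Num.Theory.
Import numFieldNormedType.Exports.

Local Open Scope classical_set_scope.
Local Open Scope ring_scope.

(** * Product expectations and Gaussian concentration *)

Section density.
Import HBNNSimple.

(** The hypothesis makes [nu] the image under [W] of the measure with density [g]. It passes from
    indicators to simple functions by linearity and to [h] by monotone convergence. The same
    statement later serves for a product of independent factors and for the normal density. *)
Lemma ge0_integral_density (R : realType) (d d' : measure_display)
    (T : measurableType d) (U : measurableType d')
    (mu : {measure set T -> \bar R}) (nu : {measure set U -> \bar R})
    (W : T -> U) (g : T -> R) (h : U -> R) :
  measurable_fun setT W -> measurable_fun setT g -> (forall x, 0 <= g x) ->
  (forall B, measurable B ->
    (\int[mu]_x (g x * \1_B (W x))%:E)%E = nu B) ->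
  measurable_fun setT h -> (forall y, 0 <= h y) ->
  (\int[mu]_x (g x * h (W x))%:E = \int[nu]_y (h y)%:E)%E.
Proof.
move=> mW mg g0 gB mh h0.
have mhE : measurable_fun setT (fun y => (h y)%:E) by exact/measurable_EFinP.
pose f := nnsfun_approx measurableT mhE.
have cf y : (f x y)%:E @[x --> \oo] --> (h y)%:E.
  by apply: (cvg_nnsfun_approx measurableT mhE) => // z _; rewrite lee_fin.
have ndf : nondecreasing_seq (f : (U -> R)^nat).
  exact: nd_nnsfun_approx.
have -> : (\int[nu]_y (h y)%:E =
    lim (\int[nu]_y (f n y)%:E @[n --> \oo]))%E.
  under eq_integral => y _.
    rewrite -(cvg_lim (@ereal_hausdorff R) (cf y)); over.
  apply: monotone_convergence => //.
  - by move=> n; exact/measurable_EFinP/measurable_funP.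
  - by move=> n y _; rewrite lee_fin.
  - by move=> y _ m n mn; rewrite lee_fin; exact/lefP/ndf.
have -> : (\int[mu]_x (g x * h (W x))%:E =
    lim (\int[mu]_x (g x * f n (W x))%:E @[n --> \oo]))%E.
  have cgf x : (g x * f n (W x))%:E @[n --> \oo] --> (g x * h (W x))%:E.
    under eq_fun do rewrite EFinM.
    by rewrite EFinM; apply: cvgeZl => //; exact: cf.
  under eq_integral => x _.
    rewrite -(cvg_lim (@ereal_hausdorff R) (cgf x)); over.
  apply: monotone_convergence => //.
  - move=> n; apply/measurable_EFinP; apply: measurable_funM => //.
    exact: measurableT_comp.
  - by move=> n x _; rewrite lee_fin mulr_ge0.
  - move=> x _ m n mn; rewrite lee_fin ler_wpM2l//; exact/lefP/ndf.
congr (limn _); apply/funext => n.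
have mpre y : measurable (f n @^-1` [set y]).
  by rewrite -[X in measurable X]setTI; apply: (measurable_funP (f n)).
transitivity (\int[nu]_y
   (\sum_(r \in range (f n)) (r * \1_(f n @^-1` [set r]) y)%:E))%E; last first.
  by apply: eq_integral => y _; rewrite [in RHS]fimfunE -fsumEFin.
rewrite ge0_integral_fsum//; last 2 first.
- by move=> r; apply/measurable_EFinP; apply: measurable_funM.
- by move=> r y _; exact: nnfun_muleindic_ge0.
transitivity (\int[mu]_x
   (\sum_(r \in range (f n)) (g x * (r * \1_(f n @^-1` [set r]) (W x)))%:E))%E.
  apply: eq_integral => x _; rewrite fimfunE.
  rewrite EFinM -fsumEFin// ge0_mule_fsumr//; last first.
    by move=> r; exact: nnfun_muleindic_ge0.
rewrite ge0_integral_fsum//; last 2 first.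
- move=> r; apply/measurable_EFinP; apply: measurable_funM => //.
  apply: measurable_funM => //.
  by apply: (measurableT_comp _ mW); exact: measurable_indic.
- move=> r x _; rewrite EFinM mule_ge0 ?lee_fin//.
  by have := nnfun_muleindic_ge0 (f n) r (W x); rewrite lee_fin.
apply: eq_fsbigr => r /[!inE] -[y _ <-].
have fy0 : 0 <= f n y by [].
transitivity (\int[mu]_x
    ((f n y)%:E * (g x * \1_(f n @^-1` [set f n y]) (W x))%:E))%E.
  by apply: eq_integral => x _; rewrite -EFinM mulrCA.
rewrite ge0_integralZl_EFin//; last 2 first.
- by move=> x _; rewrite lee_fin mulr_ge0.
- apply/measurable_EFinP; apply: measurable_funM => //.
  by apply: (measurableT_comp _ mW); exact: measurable_indic.
rewrite gB//.
under [RHS]eq_integral do rewrite EFinM.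
rewrite ge0_integralZl_EFin//; last first.
  by apply/measurable_EFinP; exact: measurable_indic.
by rewrite integral_indic// setIT.
Qed.

End density.

(** Independence is known only for events, so the indicators are replaced by general factors one at
    a time. *)
Lemma integral_prod_indep (R : realType) (d : measure_display)
    (T : measurableType d) (P : {measure set T -> \bar R})
    (nu : probability (measurableTypeR R) R)
    (n : nat) (W : 'I_n -> T -> R) (h : 'I_n -> R -> R) (e : 'I_n -> R) :
  (forall i, measurable_fun setT (W i)) ->
  (forall B : 'I_n -> set R, (forall i, measurable (B i)) ->
    P [set w | forall i, B i (W i w)] = (\prod_(i < n) nu (B i))%E) ->
  (forall i, measurable_fun setT (h i)) -> (forall i x, 0 <= h i x) ->
  (forall i, (\int[nu]_x (h i x)%:E)%E = (e i)%:E) ->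
  (\int[P]_w (\prod_(i < n) h i (W i w))%:E)%E = (\prod_(i < n) e i)%:E.
Proof.
move=> mW PW.
(* Factors of index at least [k] are still indicators. For [k = 0] the claim is the product formula
   for events, and each step frees the factor of index [k]. *)
suff H k : (k <= n)%N -> forall (h : 'I_n -> R -> R) (e : 'I_n -> R),
    (forall i : 'I_n, (k <= i)%N -> exists2 B, measurable B & h i = \1_B) ->
    (forall i, measurable_fun setT (h i)) -> (forall i x, 0 <= h i x) ->
    (forall i, (\int[nu]_x (h i x)%:E)%E = (e i)%:E) ->
    (\int[P]_w (\prod_(i < n) h i (W i w))%:E)%E = (\prod_(i < n) e i)%:E.
  by apply: (H n) => // i; rewrite leqNgt ltn_ord.
elim: k => [_|k IH kn] {}h {}e hB mh h0 he.
  have /choice[B HB] : forall i, exists B, measurable B /\ h i = \1_B.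
    by move=> i; have [//|B mB ->] := hB i; exists B.
  transitivity (\int[P]_w (\1_[set w | forall i, B i (W i w)] w)%:E)%E.
    apply: eq_integral => w _; congr (_%:E).
    rewrite indicE; have [/set_mem/= Bw|] := boolP (w \in _).
      by rewrite big1// => i _; rewrite (HB i).2 indicE mem_set.
    move=> /negP wN.
    have [i Bi] : exists i, ~ B i (W i w).
      by apply/existsNP => Bw; apply: wN; rewrite inE.
    by rewrite (bigD1 i)//= (HB i).2 indicE memNset ?mul0r.
  have mI : measurable [set w | forall i, B i (W i w)].
    rewrite (_ : mkset _ = \bigcap_(i in [set: 'I_n]) (W i @^-1` B i)).
      apply: fin_bigcap_measurable; first exact: finite_finset.
      by move=> i _; rewrite -[X in measurable X]setTI; apply: mW; have [] := HB i.
    by apply/seteqP; split => w /= Hw i; [move=> _|]; exact: Hw.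
  rewrite integral_indic// setIT PW; last by move=> i; have [] := HB i.
  rewrite -prodEFin; apply: eq_bigr => i _; rewrite -he.
  have [mB ->] := HB i; rewrite integral_indic// setIT//.
pose i0 := Ordinal kn.
have e0 i : 0 <= e i.
  by rewrite -lee_fin -he; apply: integral_ge0 => x _; rewrite lee_fin.
pose c := \prod_(i < n | i != i0) e i.
have c0 : 0 <= c by apply: prodr_ge0 => i _.
have mg : measurable_fun setT (fun w => \prod_(i < n | i != i0) h i (W i w)).
  rewrite (_ : (fun _ => _) = (fun w => \prod_(i <- [seq i <- enum 'I_n | i != i0]) h i (W i w))); last first.
    by apply/funext => w; rewrite big_filter enumT.
  by apply: measurable_prod => i _; exact: measurableT_comp.
transitivity (\int[P]_w (\prod_(i < n | i != i0) h i (W i w)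
    * h i0 (W i0 w))%:E)%E.
  by apply: eq_integral => w _; rewrite (bigD1 i0)//= mulrC.
(* The other factors act as a density; by the induction hypothesis the image measure under [W i0] is
   [nu] scaled by the product [c] of their integrals. *)
rewrite (ge0_integral_density (nu := mscale (NngNum c0) nu))//.
- rewrite ge0_integral_mscale//=.
  - by rewrite he -EFinM (bigD1 i0)//= mulrC.
  - by apply/measurable_EFinP; exact: mh.
  - by move=> x _; rewrite lee_fin.
- exact: mW.
- by move=> w; apply: prodr_ge0 => i _.
- move=> B mB.
  pose h' i := if i == i0 then \1_B else h i.
  have nuB : nu B \is a fin_num by exact: fin_num_measure.
  pose e' i := if i == i0 then fine (nu B) else e i.
  have := IH (ltnW kn) h' e'; rewrite /mscale/=.
  rewrite (bigD1 i0)//= /e' eqxx EFinM fineK// muleC.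
  rewrite [in X in _ -> _ -> _ -> _ -> _ = X](eq_bigr e); last first.
    by move=> i /negbTE ->.
  move=> E; transitivity ((\prod_(i < n | i != i0) e i)%:E * nu B)%E; last by [].
  rewrite -E.
  - apply: eq_integral => w _; rewrite [in RHS](bigD1 i0)//= /h' eqxx mulrC.
    by congr (_ * _)%:E; apply: eq_bigr => i /negbTE ->.
  - move=> i ki; rewrite /h'; case: eqP => [_|/eqP ii0]; first by exists B.
    apply: hB; rewrite ltn_neqAle ki andbT.
    by apply: contraNneq ii0 => kE; apply/eqP/val_inj.
  - move=> i; rewrite /h'; case: eqP => // _; exact: measurable_indic.
  - by move=> i x; rewrite /h'; case: eqP.
  - move=> i; rewrite /h' /e'; case: eqP => // _.
    by rewrite integral_indic// setIT fineK.
- exact: mh.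
Qed.

(** With D = 1 - 2 th s^2, multiplying the N(0, s^2) density by exp(th x^2) gives D^(-1/2) times the
    normal density with standard deviation s / sqrt D. *)
Lemma integral_normal_prob_expR_sq (R : realType) (s th : R) : 0 < s ->
  th * s ^+ 2 *+ 2 < 1 ->
  (\int[normal_prob 0 s]_x (expR (th * x ^+ 2))%:E =
    (Num.sqrt (1 - th * s ^+ 2 *+ 2))^-1%:E)%E.
Proof.
move=> s0 ths; set D := 1 - _.
have D0 : 0 < D by rewrite subr_gt0.
have sD0 : 0 < Num.sqrt D by rewrite sqrtr_gt0.
have s'0 : s / Num.sqrt D != 0 by rewrite mulf_neq0 ?invr_neq0 ?gt_eqF.
have mexp : measurable_fun [set: R] (fun x : R => expR (th * x ^+ 2)).
  by apply: measurableT_comp => //; exact: measurable_funM.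
transitivity (\int[lebesgue_measure]_x
    (normal_pdf 0 s x * expR (th * x ^+ 2))%:E)%E.
  apply/esym/(ge0_integral_density (W := idfun)).
  - exact: measurable_id.
  - exact: measurable_normal_pdf.
  - by move=> x; exact: normal_pdf_ge0.
  - move=> B mB; rewrite /normal_prob [RHS]integral_mkcond.
    apply: eq_integral => x _; rewrite patchE indicE.
    by case: ifPn => _; rewrite ?mulr1 ?mulr0.
  - exact: mexp.
  - by move=> x; exact: expR_ge0.
transitivity (\int[lebesgue_measure]_x
   ((Num.sqrt D)^-1%:E * (normal_pdf 0 (s / Num.sqrt D) x)%:E))%E.
  apply: eq_integral => x _; rewrite -EFinM; congr (_%:E).
  rewrite !normal_pdfE//; last by rewrite gt_eqF.
  rewrite /normal_peak /normal_fun /=.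
  rewrite exprMn exprVn sqr_sqrtr; last exact: ltW.
  rewrite -[LHS]mulrA [RHS]mulrA -expRD; congr (_ * expR _).
    rewrite -invfM; congr (_^-1).
    rewrite -sqrtrM; last exact: ltW.
    congr (Num.sqrt _).
    by rewrite -!mulrnAr [RHS]mulrA [D * _]mulrC divfK ?gt_eqF.
  have -> : s ^+ 2 / D *+ 2 = s ^+ 2 *+ 2 / D by rewrite mulrnAl.
  rewrite !subr0 [in RHS]invfM invrK.
  have : s ^+ 2 *+ 2 != 0 by rewrite mulrn_eq0/= sqrf_eq0 gt_eqF.
  rewrite /D -mulrnAr; move: (s ^+ 2 *+ 2) (x ^+ 2) => a b a0.
  by field.
rewrite ge0_integralZl_EFin//.
- by rewrite integral_normal_pdf mule1.
- by move=> x _; rewrite lee_fin normal_pdf_ge0.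
- by apply/measurable_EFinP; exact: measurable_normal_pdf.
Qed.

(** It follows from (1 - y)(1 + y + 2 y^2) = 1 + y^2 (1 - 2 y). Negative [y] is covered too, as the
    lower tail requires. *)
Lemma expR_le_oneB (R : realType) (y : R) :
  y <= 2^-1 -> expR (- (y + y ^+ 2 *+ 2)) <= 1 - y.
Proof.
move=> y2; have e0 := expR_gt0 (y + y ^+ 2 *+ 2).
rewrite expRN -div1r ler_pdivrMr//.
have h := expR_ge1Dx (y + y ^+ 2 *+ 2).
apply: (@le_trans _ _ ((1 - y) * (1 + (y + y ^+ 2 *+ 2)))); last first.
  by rewrite ler_wpM2l//; lra.
have -> : (1 - y) * (1 + (y + y ^+ 2 *+ 2)) = 1 + y ^+ 2 * (1 - y *+ 2).
  by ring.
by rewrite lerDl mulr_ge0 ?sqr_ge0//; lra.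
Qed.

(** Centring removes the first-order term: with y = 2 th s^2, (1 - y)^(-1/2) is at most exp(y / 2 +
    y^2), and y / 2 = th s^2 cancels. *)
Lemma integral_normal_prob_sq_mgf (R : realType) (s th : R) : 0 < s ->
  th * s ^+ 2 *+ 2 <= 2^-1 ->
  exists e : R, 0 <= e <= expR (th ^+ 2 * s ^+ 4 *+ 4) /\
  (\int[normal_prob 0 s]_x (expR (th * (x ^+ 2 - s ^+ 2)))%:E = e%:E)%E.
Proof.
move=> s0 ths; set y := th * s ^+ 2 *+ 2.
have y1 : y < 1 by rewrite (le_lt_trans ths)//; lra.
exists (expR (- (th * s ^+ 2)) * (Num.sqrt (1 - y))^-1); split.
  rewrite mulr_ge0 ?expR_ge0 ?invr_ge0 ?sqrtr_ge0//=.
  have D0 : 0 < 1 - y by rewrite subr_gt0.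
  rewrite ler_pdivrMr ?sqrtr_gt0//.
  have -> : expR (- (th * s ^+ 2)) =
      expR (th ^+ 2 * s ^+ 4 *+ 4) * expR (- (y + y ^+ 2 *+ 2) / 2).
    by rewrite -expRD; congr expR; rewrite /y; field.
  rewrite ler_wpM2l ?expR_ge0// -(ler_pXn2r (n := 2))// ?nnegrE ?expR_ge0 ?sqrtr_ge0//.
  rewrite sqr_sqrtr ?(ltW D0)// -expRM_natl.
  by rewrite (_ : 2%:R * _ = - (y + y ^+ 2 *+ 2)) ?expR_le_oneB//; field.
rewrite EFinM -integral_normal_prob_expR_sq//.
rewrite -ge0_integralZl_EFin//.
- apply: eq_integral => x _; rewrite -EFinM -expRD; congr (expR _)%:E.
  by ring.
- apply/measurable_EFinP; apply: measurableT_comp => //.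
  by apply: measurable_funM => //; exact: exprn_measurable.
Qed.

(** Exponential Markov inequality. The threshold is on [th] times the sum, so that the sign of [th]
    selects the tail. *)
Lemma normal_sq_chernoff (R : realType) (d : measure_display)
    (T : measurableType d) (P : probability T R) (n : nat)
    (W : 'I_n -> T -> R) (s th t : R) : 0 < s ->
  (forall i, measurable_fun setT (W i)) ->
  (forall B : 'I_n -> set R, (forall i, measurable (B i)) ->
    P [set w | forall i, B i (W i w)] =
    (\prod_(i < n) normal_prob 0 s (B i))%E) ->
  th * s ^+ 2 *+ 2 <= 2^-1 ->
  (P [set w | (t <= th * \sum_(i < n) (W i w ^+ 2 - s ^+ 2))%R] <=
    (expR ((th ^+ 2 * s ^+ 4 *+ 4) *+ n - t))%:E)%E.
Proof.
move=> s0 mW PW ths; set A := [set w | _].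
have [e [/andP[e0 ele] eE]] := integral_normal_prob_sq_mgf s0 ths.
have mS : measurable_fun [set: T]
    (fun w => th * \sum_(i < n) (W i w ^+ 2 - s ^+ 2)).
  apply: measurable_funM => //; apply: measurable_sum => i.
  by apply: measurable_funB => //; exact: measurable_funX.
have mA : measurable A.
  rewrite -[A]setTI; exact: measurable_fun_le.
have mh : measurable_fun [set: R] (fun x : R => expR (th * (x ^+ 2 - s ^+ 2))).
  apply: measurableT_comp => //; apply: measurable_funM => //.
  by apply: measurable_funB => //; exact: exprn_measurable.
have := @integral_prod_indep _ _ _ P (normal_prob 0 s) n W
  (fun _ x => expR (th * (x ^+ 2 - s ^+ 2))) (fun=> e) mW PW
  (fun=> mh) (fun i x => expR_ge0 _) (fun=> eE).
under eq_integral => w _ do rewrite -expR_sum -mulr_sumr.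
rewrite prodr_const card_ord => IE.
have : ((expR t)%:E * P A <= (e ^+ n)%:E)%E.
  rewrite -IE -[A]setIT -integral_indic// -ge0_integralZl_EFin//; last first.
    exact/measurable_EFinP.
  apply: ge0_le_integral => //.
  - by apply/measurable_EFinP; apply: measurable_funM.
  - by apply/measurable_EFinP; exact: measurableT_comp.
  - move=> w _; rewrite -EFinM lee_fin indicE.
    have [/set_mem Aw|_] := boolP (w \in A); last by rewrite mulr0 expR_ge0.
    by rewrite mulr1 ler_expR.
rewrite -(@fineK _ (P A)) ?fin_num_measure// -EFinM !lee_fin => PAe.
rewrite -(ler_pM2l (expR_gt0 t)) -expRD addrC subrK (le_trans PAe)//.
by rewrite -mulr_natl expRM_natl lerXn2r ?nnegrE ?expR_ge0.
Qed.

(** For th = n^(-1/2) and th = - n^(-1/2) the second-order term n (4 th^2 s^4) is the constant 4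
    s^4; the lower bound on [n] makes these parameters admissible. *)
Lemma normal_sq_concentration (R : realType) (d : measure_display)
    (T : measurableType d) (P : probability T R) (n : nat)
    (W : 'I_n -> T -> R) (s M : R) : 0 < s -> (0 < n)%N ->
  (forall i, measurable_fun setT (W i)) ->
  (forall B : 'I_n -> set R, (forall i, measurable (B i)) ->
    P [set w | forall i, B i (W i w)] =
    (\prod_(i < n) normal_prob 0 s (B i))%E) ->
  (s ^+ 2 *+ 4) ^+ 2 <= n%:R ->
  (P [set w | (M <= (Num.sqrt n%:R)^-1 *
      `|\sum_(i < n) (W i w ^+ 2 - s ^+ 2)|)%R] <=
    (2 * expR (s ^+ 4 *+ 4 - M))%:E)%E.
Proof.
move=> s0 n0 mW PW sn; set r := Num.sqrt n%:R.
have r0 : 0 < r by rewrite sqrtr_gt0 ltr0n.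
have rr : r ^+ 2 = n%:R by rewrite sqr_sqrtr// ler0n.
have sr : s ^+ 2 *+ 4 <= r.
  rewrite -(ler_pXn2r (n := 2))// ?nnegrE ?rr//; last exact: ltW.
  by rewrite mulrn_wge0// sqr_ge0.
have mS th : measurable_fun [set: T]
    (fun w => th * \sum_(i < n) (W i w ^+ 2 - s ^+ 2)).
  apply: measurable_funM => //; apply: measurable_sum => i.
  by apply: measurable_funB => //; exact: measurable_funX.
have mA th : measurable [set w | M <= th * \sum_(i < n) (W i w ^+ 2 - s ^+ 2)].
  rewrite -[X in measurable X]setTI; exact: measurable_fun_le.
have rn : (r^-1 ^+ 2 * s ^+ 4 *+ 4) *+ n = s ^+ 4 *+ 4.
  rewrite exprVn rr; field.
  by rewrite pnatr_eq0 -lt0n.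
apply: (@le_trans _ _ (P ([set w | (M <= r^-1 * \sum_(i < n) (W i w ^+ 2 - s ^+ 2))%R]
   `|` [set w | (M <= (- r^-1) * \sum_(i < n) (W i w ^+ 2 - s ^+ 2))%R]))).
  apply: le_measure; rewrite ?inE//.
  - rewrite -[X in measurable X]setTI; apply: measurable_fun_le => //.
    apply: measurable_funM => //; apply: measurableT_comp => //.
    apply: measurable_sum => i.
    by apply: measurable_funB => //; exact: measurable_funX.
  - exact: measurableU.
  - move=> w /=; case: (ger0P (\sum_(i < n) (W i w ^+ 2 - s ^+ 2))) => _.
      by left.
    by rewrite mulrN mulNr; right.
apply: (le_trans (measureU2 _ _ _)) => //.
have -> : (2 * expR (s ^+ 4 *+ 4 - M))%:E =
    ((expR (s ^+ 4 *+ 4 - M))%:E + (expR (s ^+ 4 *+ 4 - M))%:E)%E.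
  by rewrite -EFinD mulr_natl mulr2n.
have rs : r^-1 * s ^+ 2 *+ 2 <= 2^-1.
  rewrite -mulrnAr mulrC ler_pdivrMr//.
  by move: sr; lra.
apply: leeD; apply: (le_trans (normal_sq_chernoff _ s0 mW PW _)) => //.
- by rewrite rn.
- rewrite mulNr -mulNr mulNr mulNrn (@le_trans _ _ 0) ?oppr_le0 ?mulrn_wge0//.
  by rewrite mulr_ge0 ?invr_ge0 ?sqr_ge0 ?(ltW r0).
- by rewrite sqrrN rn.
Qed.

(** * Linear marginals of the sample and the empirical covariance *)

Lemma continuous_sumr (R : realType) (T : topologicalType) (I : Type)
    (r : seq I) (Pr : pred I) (F : I -> T -> R) :
  (forall i, Pr i -> continuous (F i)) ->
  continuous (fun x => \sum_(i <- r | Pr i) F i x).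
Proof.
by move=> cF; apply: continuous_big; [exact: (@add_continuous R^o)|exact: cF].
Qed.

(** Sets with a Borel preimage form a sigma-algebra containing the open intervals. *)
Lemma borel_preimage_continuous (R : realType) (p : nat)
    (f : 'rV[R]_p -> R) (B : set R) :
  continuous f -> measurable B -> borel (f @^-1` B).
Proof.
move=> cf mB.
have : (@ocitv R).-sigma.-measurable B by [].
rewrite RGenOpens.measurableE.
have [b0 bC bU] : sigma_algebra setT (@borel R p).
  exact: smallest_sigma_algebra.
apply: (@smallest_sub _ _ (@RGenOpens.G R) [set A | borel (f @^-1` A)]).
  split => [|A bA|A bA] /=.
  - by rewrite preimage_set0.
  - by rewrite setTD preimage_setC -setTD; exact: bC.
  - by rewrite preimage_bigcup; exact: bU.
move=> _ [x [y ->]] /=; apply: sub_sigma_algebra.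
by apply: open_comp; [move=> z _; exact: cf|exact: interval_open].
Qed.

Lemma continuous_rowmulmx (R : realType) (p : nat) (a : 'rV[R]_p) :
  continuous (fun v : 'rV[R]_p => (v *m a^T) 0 0 : R).
Proof.
have -> : (fun v : 'rV[R]_p => (v *m a^T) 0 0 : R) =
    (fun v : 'rV[R]_p => \sum_j v 0 j * a 0 j).
  by apply/funext => u; rewrite mxE; apply: eq_bigr => j _; rewrite mxE.
apply: continuous_sumr => j _ v.
by apply: continuousM; [exact: coord_continuous|exact: cst_continuous].
Qed.

Lemma gaussian_sample_linear (R : realType) (d : measure_display)
    (T : measurableType d) (P : probability T R) (n p : nat)
    (X : T -> 'M[R]_(n, p)) (S : 'M[R]_p) (a : 'rV[R]_p) :
  gaussian_sample P X S -> a != 0 ->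
  let W i w := (row i (X w) *m a^T) 0 0 in
  (forall i, measurable_fun setT (W i)) /\
  (forall B : 'I_n -> set R, (forall i, measurable (B i)) ->
    P [set w | forall i, B i (W i w)] =
    (\prod_(i < n) normal_prob 0 (Num.sqrt ((a *m S *m a^T) 0 0))%R (B i))%E).
Proof.
move=> [Xg Xi] a0 W; split => [i _ B mB|B mB].
  rewrite setTI; have [+ _] := Xg i.
  move=> /(_ ((fun v : 'rV[R]_p => (v *m a^T) 0 0) @^-1` B)).
  by apply; apply: borel_preimage_continuous => //; exact: continuous_rowmulmx.
pose B' i := (fun v : 'rV[R]_p => (v *m a^T) 0 0) @^-1` B i.
have bB' i : borel (B' i).
  by apply: borel_preimage_continuous => //; exact: continuous_rowmulmx.
rewrite -[LHS]/(P [set w | forall i, B' i (row i (X w))]) Xi//.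
by apply: eq_bigr => i _; have [_ /(_ a a0 (B i) (mB i))] := Xg i.
Qed.

Lemma gram_entry (R : realType) (n p : nat) (X : 'M[R]_(n, p)) (j k : 'I_p) :
  (X^T *m X) j k = \sum_i X i j * X i k.
Proof. by rewrite mxE; apply: eq_bigr => i _; rewrite mxE. Qed.

Lemma quad_delta (R : realType) (p : nat) (S : 'M[R]_p) (j k : 'I_p) :
  ((delta_mx 0 j : 'rV[R]_p) *m S *m (delta_mx 0 k : 'rV[R]_p)^T) 0 0 = S j k.
Proof. by rewrite -rowE trmx_delta -colE !mxE. Qed.

(** Union bound; the complement of the union is the measurable witness. *)
Lemma inner_prob_ge_forall (R : realType) (d : measure_display)
    (T : measurableType d) (P : probability T R) (I : finType)
    (A : I -> set T) (e : R) :
  (forall i, measurable (A i)) -> (forall i, (P (A i) <= e%:E)%E) ->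
  inner_prob_ge P [set w | forall i, ~ A i w] (1 - e *+ #|I|).
Proof.
move=> mA Ae; pose U (s : seq I) := \big[setU/set0]_(i <- s) A i.
have mU s : measurable (U s) by apply: bigsetU_measurable.
have PU s : (P (U s) <= (e *+ size s)%:E)%E.
  elim: s => [|i s IH]; first by rewrite /U big_nil measure0 mulr0n.
  rewrite /U big_cons mulrS EFinD; apply: (le_trans (measureU2 _ _ _)) => //.
    exact: mU.
  by apply: leeD; [exact: Ae|exact: IH].
exists (~` U (enum I)); split.
- exact: measurableC.
- by move=> w /= Aw i Ai; apply: Aw; rewrite /U -bigcup_seq; exists i; rewrite /= ?mem_enum.
rewrite probability_setC// EFinB leeB//.
by have := PU (enum I); rewrite -cardE.
Qed.

(** The vectors e_j + e_k, including 2 e_j when j = k, are the directions from which the covariance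
    entries are recovered by polarization. *)
Lemma posdef_quad_gt0 (R : realType) (p : nat) (S : 'M[R]_p) (j k : 'I_p) :
  posdef S -> let a : 'rV[R]_p := delta_mx 0 j + delta_mx 0 k in
  a != 0 /\ 0 < (a *m S *m a^T) 0 0.
Proof.
move=> [_ Spos] a; have a0 : a != 0.
  apply/eqP => /rowP /(_ j); rewrite !mxE !eqxx/= => E.
  by have := ler0n R (j == k); lra.
by split => //; exact: Spos.
Qed.

Lemma sample_covariance_whp (R : realType) (p : nat) (Sigma0 : 'M[R]_p)
    (d : measure_display) (T : measurableType d) (P : probability T R)
    (X : forall n : nat, T -> 'M[R]_(n, p)) (eps : R) :
  (0 < p)%N -> posdef Sigma0 ->
  (forall n : nat, gaussian_sample P (X n) Sigma0) -> 0 < eps ->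
  exists2 M : R, 0 < M & \forall n \near \oo,
    inner_prob_ge P [set w | forall j k,
      `|(n%:R^-1 *: ((X n w)^T *m X n w) - Sigma0) j k|
        <= M / Num.sqrt n%:R] (1 - eps).
Proof.
move=> p0 Spos Xg eps0.
pose a (jk : 'I_p * 'I_p) : 'rV[R]_p := delta_mx 0 jk.1 + delta_mx 0 jk.2.
pose v jk := (a jk *m Sigma0 *m (a jk)^T) 0 0.
pose s jk := Num.sqrt (v jk).
have v0 jk : 0 < v jk by have [] := posdef_quad_gt0 jk.1 jk.2 Spos.
have s0 jk : 0 < s jk by rewrite sqrtr_gt0.
have sv jk : s jk ^+ 2 = v jk by rewrite sqr_sqrtr ?(ltW (v0 _)).
pose K := \sum_jk s jk ^+ 4 *+ 4.
have sK jk : s jk ^+ 4 *+ 4 <= K.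
  rewrite /K (bigD1 jk)//= lerDl; apply: sumr_ge0 => i _.
  by rewrite mulrn_wge0// exprn_ge0// ltW.
pose N : R := #|{: 'I_p * 'I_p}|%:R.
have N0 : 0 < N by rewrite ltr0n card_prod card_ord muln_gt0 p0.
have K0 : 0 <= K.
  by apply: sumr_ge0 => i _; rewrite mulrn_wge0// exprn_ge0// ltW.
(* [N] events of probability at most 2 exp(-L) each have total probability at most [eps], because
   exp(L) >= L = 2 N / eps. *)
pose L := 2 * N / eps.
have L0 : 0 < L by rewrite divr_gt0// mulr_gt0.
exists (K + L); first by rewrite ltr_wpDl.
have nbig : \forall n \near \oo, (0 < n)%N /\
    forall jk, (s jk ^+ 2 *+ 4) ^+ 2 <= n%:R :> R.
  near=> n; split; first by near: n; exact: nbhs_infty_gt.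
  near: n; apply: filter_forall => jk; exact: nbhs_infty_ger.
near=> n.
have [n0 sn] : (0 < n)%N /\ forall jk, (s jk ^+ 2 *+ 4) ^+ 2 <= n%:R :> R.
  by near: n.
pose r : R := Num.sqrt n%:R.
have r0 : 0 < r by rewrite sqrtr_gt0 ltr0n.
have rr : n%:R = r * r by rewrite -expr2 sqr_sqrtr// ler0n.
pose W jk i w := (row i (X n w) *m (a jk)^T) 0 0.
pose Q jk w := \sum_(i < n) (W jk i w ^+ 2 - s jk ^+ 2).
pose A jk := [set w | K + L <= r^-1 * `|Q jk w|].
have mW jk i : measurable_fun setT (W jk i).
  have [a0 _] := posdef_quad_gt0 jk.1 jk.2 Spos.
  by have [+ _] := gaussian_sample_linear (Xg n) a0; exact.
have mA jk : measurable (A jk).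
  rewrite -[X in measurable X]setTI; apply: measurable_fun_le => //.
  apply: measurable_funM => //; apply: measurableT_comp => //.
  apply: measurable_sum => i.
  by apply: measurable_funB => //; exact: measurable_funX.
have PA jk : (P (A jk) <= (2 * expR (- L))%:E)%E.
  have [a0 _] := posdef_quad_gt0 jk.1 jk.2 Spos.
  have [_ PW] := gaussian_sample_linear (Xg n) a0.
  apply: le_trans (normal_sq_concentration _ (s0 jk) n0 (mW jk) PW (sn jk)) _.
  rewrite lee_fin ler_pM2l// ler_expR; have := sK jk; lra.
have [B [mB BA PB]] := inner_prob_ge_forall mA PA.
exists B; split => //; last first.
  apply: le_trans PB; rewrite lee_fin lerD2l lerN2 -[X in X <= _]mulr_natl -/N.
  rewrite mulrCA mulrA expRN ler_pdivrMr ?expR_gt0//.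
  have -> : 2 * N = eps * L by rewrite /L mulrCA divff ?mulr1// gt_eqF.
  rewrite ler_pM2l//; apply: le_trans (expR_ge1Dx _); lra.
move=> w /BA Aw j k.
pose D := (X n w)^T *m X n w - n%:R *: Sigma0.
have WE jk i : W jk i w = X n w i jk.1 + X n w i jk.2.
  rewrite /W mxE (eq_bigr (fun l => X n w i l * a jk 0 l)); last first.
    by move=> l _; rewrite !mxE.
  under eq_bigr do rewrite mxE mulrDr.
  rewrite big_split/=; congr (_ + _).
    rewrite (bigD1 jk.1)//= big1 ?addr0; first by rewrite mxE !eqxx mulr1.
    by move=> l /negbTE lj; rewrite mxE lj andbF mulr0.
  rewrite (bigD1 jk.2)//= big1 ?addr0; first by rewrite mxE !eqxx mulr1.
  by move=> l /negbTE lj; rewrite mxE lj andbF mulr0.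
have QE l m : Q (l, m) w = D l l + D l m *+ 2 + D m m.
  rewrite /Q big_split/= sumr_const card_ord sv.
  have -> : v (l, m) = Sigma0 l l + Sigma0 l m *+ 2 + Sigma0 m m.
    have addE (A1 A2 : 'M[R]_1) : (A1 + A2) 0 0 = A1 0 0 + A2 0 0 by rewrite mxE.
    rewrite /v /a/= linearD/= !mulmxDl !mulmxDr !addE !quad_delta.
    have -> : Sigma0 m l = Sigma0 l m by rewrite -[in LHS]Spos.1 mxE.
    by rewrite mulr2n; ring.
  have DE u u' : D u u' = \sum_i X n w i u * X n w i u' - n%:R * Sigma0 u u'.
    by rewrite /D !mxE -gram_entry !mxE.
  rewrite !DE.
  have -> : \sum_(i < n) W (l, m) i w ^+ 2 =
      \sum_i X n w i l * X n w i l + (\sum_i X n w i l * X n w i m) *+ 2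
      + \sum_i X n w i m * X n w i m.
    rewrite -sumrMnl -!big_split/=; apply: eq_bigr => i _; rewrite WE /=; ring.
  rewrite -mulr_natr; ring.
have QA jk : `|Q jk w| <= (K + L) * r.
  move: (Aw jk) => /negP; rewrite -ltNge mulrC ltr_pdivrMr//.
  exact: ltW.
(* Polarization: Q(j, j) = 4 D_jj, Q(k, k) = 4 D_kk and Q(j, k) = D_jj + 2 D_jk + D_kk, so bounding
   these three by c bounds D_jk by 3c/4. *)
have Q1 := QA (j, j); have Q2 := QA (k, k); have Q3 := QA (j, k).
rewrite !QE !ler_norml in Q1 Q2 Q3.
have -> : (n%:R^-1 *: ((X n w)^T *m X n w) - Sigma0) j k = (r * r)^-1 * D j k.
  rewrite -rr /D !mxE mulrDr; congr (_ + _).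
  by rewrite mulrN mulrA mulVf ?mul1r// pnatr_eq0 -lt0n.
rewrite normrM invfM gtr0_norm; last by rewrite mulr_gt0 ?invr_gt0.
rewrite mulrC mulrA -/r ler_pM2r ?invr_gt0// ler_pdivrMr// ler_norml.
have KLr : 0 <= (K + L) * r by rewrite mulr_ge0 ?(ltW r0)// addr_ge0// ltW.
move: ((K + L) * r) KLr Q1 Q2 Q3 => c c0 Q1 Q2 Q3; lra.
Unshelve. all: by end_near. Qed.

(** * The Gaussian likelihood on the space of DAGs *)

(** The witness, the inverse of one plus the sum of the inverses, also makes sense for an empty
    index type. *)
Lemma fin_pos_lb (R : realType) (I : finType) (f : I -> R) :
  (forall i, 0 < f i) -> exists2 r, 0 < r & forall i, r <= f i.
Proof.
move=> f0; pose s := \sum_i (f i)^-1 + 1.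
have s0 : 0 < s by rewrite ltr_wpDl// sumr_ge0// => i _; rewrite invr_ge0 ltW.
exists s^-1; first by rewrite invr_gt0.
move=> i; rewrite -[f i]invrK lef_pV2 ?posrE ?invr_gt0//.
rewrite /s (bigD1 i)//= -addrA lerDl addr_ge0// sumr_ge0// => j _.
by rewrite invr_ge0 ltW.
Qed.

(** * Euclidean norm and traces *)

Section euclidean_norm.
Variables (R : realType).

Lemma enorm_ge0 m n (A : 'M[R]_(m, n)) : 0 <= enorm A.
Proof. exact: sqrtr_ge0. Qed.

Lemma enorm_sqr m n (A : 'M[R]_(m, n)) :
  enorm A ^+ 2 = \sum_i \sum_j A i j ^+ 2.
Proof.
by rewrite sqr_sqrtr// !sumr_ge0// => i _; rewrite sumr_ge0// => j _; rewrite sqr_ge0.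
Qed.

Lemma enorm0 m n : enorm (0 : 'M[R]_(m, n)) = 0.
Proof.
rewrite /enorm big1 ?sqrtr0// => i _; rewrite big1// => j _.
by rewrite mxE expr0n.
Qed.

Lemma entry_le_enorm m n (A : 'M[R]_(m, n)) i j : `|A i j| <= enorm A.
Proof.
rewrite -(ler_pXn2r (n := 2)) ?nnegrE ?enorm_ge0// enorm_sqr real_normK ?num_real//.
rewrite (bigD1 i)//= (bigD1 j)//= -addrA lerDl addr_ge0// sumr_ge0// => k _.
  exact: sqr_ge0.
by rewrite sumr_ge0// => l _; exact: sqr_ge0.
Qed.

(** The crude factor [m * n] is enough: the rate tolerates any constant depending only on the
    dimension. *)
Lemma enorm_le_entry m n (A : 'M[R]_(m, n)) (c : R) : 0 <= c ->
  (forall i j, `|A i j| <= c) -> enorm A <= (m * n)%:R * c.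
Proof.
move=> c0 Ac; have mnc : 0 <= (m * n)%:R * c by rewrite mulr_ge0.
rewrite -(ler_pXn2r (n := 2)) ?nnegrE ?enorm_ge0// enorm_sqr.
apply: (@le_trans _ _ ((m * n)%:R * c ^+ 2)).
  rewrite natrM -mulrA mulr_natl -[X in _ <= _ *+ X]card_ord -sumr_const.
  apply: ler_sum => i _; rewrite mulr_natl -[X in _ <= _ *+ X]card_ord -sumr_const.
  apply: ler_sum => j _; rewrite -real_normK ?num_real//.
  by rewrite lerXn2r ?nnegrE.
rewrite exprMn ler_wpM2r ?sqr_ge0// -natrX ler_nat -mulnn.
by case: (m * n)%N => // k; rewrite leq_pmulr.
Qed.

Lemma mulmx_entry_le m n k (A : 'M[R]_(m, n)) (B : 'M[R]_(n, k)) (a b : R) :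
  (forall i j, `|A i j| <= a) -> (forall i j, `|B i j| <= b) ->
  forall i j, `|(A *m B) i j| <= n%:R * (a * b).
Proof.
move=> Aa Bb i j; rewrite mxE (le_trans (ler_norm_sum _ _ _))//.
rewrite mulr_natl -[X in _ <= _ *+ X]card_ord -sumr_const.
by apply: ler_sum => l _; rewrite normrM ler_pM.
Qed.

Lemma mxtrace_trmulE m n (A B : 'M[R]_(m, n)) :
  \tr (A^T *m B) = \sum_i \sum_j A i j * B i j.
Proof.
rewrite exchange_big/= /mxtrace; apply: eq_bigr => j _.
by rewrite mxE; apply: eq_bigr => i _; rewrite mxE.
Qed.

Lemma mxtrace_trmul_self m n (A : 'M[R]_(m, n)) :
  \tr (A^T *m A) = enorm A ^+ 2.
Proof.
rewrite mxtrace_trmulE enorm_sqr.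
by apply: eq_bigr => i _; apply: eq_bigr => j _; rewrite expr2.
Qed.

Lemma mxtrace_trmul_le m n (A B : 'M[R]_(m, n)) (c : R) :
  (forall i j, `|B i j| <= c) ->
  `|\tr (A^T *m B)| <= (m * n)%:R * (enorm A * c).
Proof.
move=> Bc; rewrite mxtrace_trmulE (le_trans (ler_norm_sum _ _ _))//.
rewrite natrM -mulrA mulr_natl -[X in _ <= _ *+ X]card_ord -sumr_const.
apply: ler_sum => i _; rewrite (le_trans (ler_norm_sum _ _ _))//.
rewrite mulr_natl -[X in _ <= _ *+ X]card_ord -sumr_const.
apply: ler_sum => j _; rewrite normrM ler_pM//.
exact: entry_le_enorm.
Qed.

Lemma enormD_sqr_le m n (A B : 'M[R]_(m, n)) :
  enorm (A + B) ^+ 2 <= (enorm A ^+ 2 + enorm B ^+ 2) *+ 2.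
Proof.
have h (a b : R) : (a + b) ^+ 2 <= (a ^+ 2 + b ^+ 2) *+ 2.
  rewrite -subr_ge0 (_ : _ - _ = (a - b) ^+ 2) ?sqr_ge0//.
  by ring.
rewrite !enorm_sqr -big_split -sumrMnl; apply: ler_sum => i _.
rewrite -big_split -sumrMnl; apply: ler_sum => j _.
rewrite mxE.
exact: h.
Qed.

End euclidean_norm.

(** * The factor R - Phi as a coordinate on the DAG space *)

Section cholesky_parametrization.
Variables (R : realType) (p : nat).
Implicit Types (nu : 'rV[R]_(p * p)) (S : 'M[R]_p).

Lemma unvecE nu i j : unvec nu i j = nu 0 (mxvec_index j i).
Proof. by rewrite /unvec !mxE. Qed.

Lemma nu_of_id nu : nu = nu_of (Phi_of nu) (rho_of nu).
Proof.
rewrite /nu_of /vec; have -> : diag_mx (rho_of nu) + Phi_of nu = unvec nu.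
  apply/matrixP => i j; rewrite !mxE.
  by case: eqP => [->|_]; rewrite ?mulr1n ?addr0 ?mulr0n ?add0r.
by rewrite /unvec trmxK vec_mxK.
Qed.

Lemma dag_spaceP nu : dag_space nu <->
  is_dag (Phi_of nu) /\ forall j, 0 < rho_of nu 0 j.
Proof.
split => [[Phi [rho [dPhi rho0 ->]]]|[dPhi rho0]].
  by have [-> ->] := nu_ofK rho dPhi.
by exists (Phi_of nu), (rho_of nu); split => //; exact: nu_of_id.
Qed.

(** The factor B with Theta = B B^T; on a DAG it is triangular up to a reordering of the
    vertices. *)
Definition chol nu : 'M[R]_p := diag_mx (rho_of nu) - Phi_of nu.

Lemma cholE nu i j :
  chol nu i j = if i == j then unvec nu i j else - unvec nu i j.
Proof.
rewrite /chol !mxE; case: eqP => [->|_]; first by rewrite mulr1n subr0.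
by rewrite mulr0n sub0r.
Qed.

(** Passing from [nu] to [chol nu] permutes the coordinates and flips the signs of the off-diagonal
    ones, so it is an isometry. *)
Lemma enorm_cholB nu nu' : enorm (chol nu - chol nu') = enorm (nu - nu').
Proof.
congr Num.sqrt; rewrite [in RHS]big_ord1.
rewrite pair_big/= [RHS](reindex (uncurry (@mxvec_index p p)))/=; last first.
  exact: curry_mxvec_bij.
rewrite [RHS](reindex (fun ij : 'I_p * 'I_p => (ij.2, ij.1)))/=; last first.
  by exists (fun ij => (ij.2, ij.1)) => -[].
apply: eq_bigr => -[i j] _ /=.
have -> (A B : 'M[R]_p) : (A - B) i j = A i j - B i j by rewrite !mxE.
have -> : (nu - nu') 0 (mxvec_index j i) = unvec nu i j - unvec nu' i j.
  by rewrite !unvecE !mxE.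
rewrite !cholE; case: eqP => // _.
by rewrite -opprD sqrrN.
Qed.

End cholesky_parametrization.

(** The rank is the number of ancestors, the vertex itself included. Along an edge from i to j it
    grows strictly, since j is no ancestor of i without a cycle. *)
Lemma dag_rank (R : realType) (p : nat) (Phi : 'M[R]_p) : is_dag Phi ->
  exists h : 'I_p -> nat, forall i j, Phi i j != 0 -> (h i < h j)%N.
Proof.
move=> dag; pose e : rel 'I_p := fun i j => Phi i j != 0.
exists (fun j => #|[pred k | connect e k j]|) => i j eij.
apply: proper_card; apply/properP; split.
  by apply/fintype.subsetP => k; rewrite !inE => ki; exact: connect_trans (connect1 eij).
exists j; rewrite !inE ?connect0//.
apply/negP => /connectP[s es Ei].
have : cycle e (j :: s) by rewrite /= rcons_path es -Ei.
by move=> /dag.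
Qed.

(** Back substitution for a triangular system: in row i of the product only vertices of rank above
    [h i] contribute besides the diagonal, and their entries of [M] in column j already vanish. *)
Lemma tr_inverse_diag (R : realType) (p : nat) (rho : 'rV[R]_p)
    (Phi M : 'M[R]_p) (h : 'I_p -> nat) :
  (forall j, 0 < rho 0 j) -> (forall i j, Phi i j != 0 -> (h i < h j)%N) ->
  (diag_mx rho - Phi) *m M = 1%:M ->
  forall i j, (h j <= h i)%N -> rho 0 i * M i j = (i == j)%:R.
Proof.
move=> rho0 hPhi BM.
pose N := \max_i h i.
(* Induction downwards from the maximal rank [N]; for n = 0 the premise N < h i is impossible. *)
suff H n : forall i j, (N < h i + n)%N -> (h j <= h i)%N ->
    rho 0 i * M i j = (i == j)%:R.
  by move=> i j; apply: (H N.+1); rewrite addnS ltnS leq_addl.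
elim: n => [i j|n IH i j Ni hji].
  by rewrite addn0 ltnNge /N leq_bigmax.
have := congr1 (fun A : 'M[R]_p => A i j) BM.
rewrite !mxE (bigD1 i)//= big1 ?addr0.
  rewrite !mxE eqxx mulr1n (_ : Phi i i = 0) ?subr0//.
  by apply/eqP; apply: contraT => /hPhi; rewrite ltnn.
move=> k ki; rewrite !mxE eq_sym (negbTE ki) mulr0n sub0r.
have [->|/hPhi hik] := eqVneq (Phi i k) 0; first by rewrite oppr0 mul0r.
have kj : (k == j) = false.
  by apply/eqP => E; move: hik; rewrite E ltnNge hji.
have /eqP : rho 0 k * M k j = (k == j)%:R.
  apply: IH; last exact: leq_trans hji (ltnW hik).
  by apply: leq_trans Ni _; rewrite addnS -addSn leq_add2r.
by rewrite kj mulf_eq0 gt_eqF//= => /eqP ->; rewrite mulr0.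
Qed.

Section likelihood.
Variables (R : realType) (p : nat).
Implicit Types (nu : 'rV[R]_(p * p)) (S : 'M[R]_p).

Definition mean_loglik S nu : R :=
  \sum_j ln (rho_of nu 0 j) - 2^-1 * \tr ((chol nu)^T *m (S *m chol nu)).

Lemma loglikE n (X : 'M[R]_(n, p)) nu : (0 < n)%N ->
  loglik X nu = n%:R * mean_loglik (n%:R^-1 *: (X^T *m X)) nu.
Proof.
move=> n0; rewrite /loglik /mean_loglik big_split/= mulrBr mulr_sumr; congr (_ + _).
rewrite -scalemxAl -scalemxAr mxtraceZ mulrCA [n%:R * (_ * _)]mulrA.
rewrite mulfV ?pnatr_eq0 -?lt0n// mul1r.
rewrite !mulmxA -trmx_mul -!mulmxA mxtrace_trmul_self enorm_sqr exchange_big/=.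
rewrite mulr_sumr -sumrN; apply: eq_bigr => j _; congr (- (_ * _)).
rewrite enorm_sqr; apply: eq_bigr => i _; rewrite big_ord1; congr (_ ^+ 2).
rewrite /chol mulmxBr mul_mx_diag !mxE mulrC; congr (_ - _).
by apply: eq_bigr => k _; rewrite !mxE.
Qed.

Lemma tr_quad_add S (B H : 'M[R]_p) : S^T = S ->
  \tr ((B + H)^T *m (S *m (B + H))) =
  \tr (B^T *m (S *m B)) + \tr (H^T *m (S *m B)) *+ 2 + \tr (H^T *m (S *m H)).
Proof.
move=> Ssym; rewrite linearD/= !mulmxDr !mulmxDl !mxtraceD.
have -> : \tr (B^T *m (S *m H)) = \tr (H^T *m (S *m B)).
  by rewrite -mxtrace_tr !trmx_mul Ssym trmxK mulmxA.
by rewrite mulr2n; ring.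
Qed.

Variables (Sigma0 : 'M[R]_p) (nu0 : 'rV[R]_(p * p)).
Hypothesis Spos : posdef Sigma0.
Hypothesis hnu0 : equiv_dags (invmx Sigma0) nu0.

Let B0 := chol nu0.
(** This is the inverse of [B0], because B0 B0^T is the inverse of Sigma0. *)
Let M := B0^T *m Sigma0.

Lemma posdef_unitmx : Sigma0 \in unitmx.
Proof.
rewrite -row_free_unit -kermx_eq0; apply/rowV0P => v /sub_kermxP vS.
apply/eqP; apply: contraT => v0.
by have := Spos.2 v v0; rewrite vS mul0mx mxE ltxx.
Qed.

Lemma chol_inverse : B0 *m M = 1%:M.
Proof.
rewrite /M mulmxA; have [_] := hnu0; rewrite /Theta -/(chol nu0) -/B0 => ->.
by rewrite mulVmx// posdef_unitmx.
Qed.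

Lemma chol_gram : M^T *m M = Sigma0.
Proof.
have [Ssym _] := Spos.
by rewrite /M trmx_mul trmxK Ssym -mulmxA chol_inverse mulmx1.
Qed.

(** At S = Sigma0 the trace is the squared norm of M H, and H = B0 (M H) bounds |H| by c |M H|. This
    gives 2 mu |H|^2; half of it absorbs the perturbation S - Sigma0. *)
Lemma covariance_coercive : exists2 mu : R, 0 < mu &
  exists2 d1 : R, 0 < d1 & forall S,
    (forall j k, `|(S - Sigma0) j k| <= d1) ->
    forall H : 'M[R]_p, mu * enorm H ^+ 2 <= \tr (H^T *m (S *m H)).
Proof.
pose c : R := (p * p)%:R * (p%:R * enorm B0) + 1.
have c1 : 1 <= c by rewrite lerDr !mulr_ge0// enorm_ge0.
have c0 : 0 < c by rewrite (lt_le_trans _ c1).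
pose q : R := (p * p)%:R * p%:R + 1.
have q0 : 0 < q by rewrite ltr_wpDl// mulr_ge0.
pose mu := (c ^+ 2)^-1 / 2.
have mu0 : 0 < mu by rewrite divr_gt0// invr_gt0 exprn_gt0.
have HM (H : 'M[R]_p) : enorm H ^+ 2 / c ^+ 2 <= \tr (H^T *m (Sigma0 *m H)).
  have -> : Sigma0 *m H = M^T *m (M *m H) by rewrite mulmxA chol_gram.
  rewrite mulmxA -trmx_mul mxtrace_trmul_self.
  rewrite ler_pdivrMr ?exprn_gt0// -exprMn lerXn2r ?nnegrE ?enorm_ge0//.
    by rewrite mulr_ge0 ?enorm_ge0 ?(ltW c0).
  have HE : H = B0 *m (M *m H) by rewrite mulmxA chol_inverse mul1mx.
  rewrite {1}HE (le_trans (@enorm_le_entry R p p _ _ _ (mulmx_entry_le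
    (entry_le_enorm B0) (entry_le_enorm (M *m H)))))//.
    by rewrite !mulr_ge0 ?enorm_ge0.
  rewrite /c mulrDr mulr1.
  apply: (@le_trans _ _ (enorm (M *m H) * ((p * p)%:R * (p%:R * enorm B0)))).
    by rewrite le_eqVlt; apply/orP; left; apply/eqP; ring.
  by rewrite lerDl enorm_ge0.
(* With entries of S - Sigma0 at most mu / q, the perturbation contributes at most p^3 (mu / q)
   |H|^2 <= mu |H|^2. *)
exists mu => //; exists (mu / q); first by rewrite divr_gt0.
move=> S Sd H; set N := enorm H.
have -> : S = Sigma0 + (S - Sigma0) by rewrite addrC subrK.
rewrite mulmxDl mulmxDr mxtraceD.
have N0 : 0 <= N by exact: enorm_ge0.
have := mxtrace_trmul_le H (mulmx_entry_le Sd (entry_le_enorm H)).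
rewrite ler_norml -/N => /andP[lo _]; have := HM H; rewrite -/N => HMH.
have muq : (p * p)%:R * (N * (p%:R * (mu / q * N))) <= mu * N ^+ 2.
  have -> : (p * p)%:R * (N * (p%:R * (mu / q * N))) =
    mu * N ^+ 2 * (((p * p)%:R * p%:R) / q) by ring.
  rewrite ler_piMr//; first by rewrite mulr_ge0 ?sqr_ge0 ?(ltW mu0).
  by rewrite ler_pdivrMr// mul1r /q lerDl.
have E : N ^+ 2 / c ^+ 2 = mu * N ^+ 2 + mu * N ^+ 2.
  by rewrite /mu; field; rewrite gt_eqF.
by move: lo HMH muq; rewrite E; lra.
Qed.

(** Deleting an edge of [nu0] moves it by at least the size of that entry, while the radius is at
    most half of every nonzero entry. *)
Lemma support_stable : exists2 r0 : R, 0 < r0 & forall nu i j,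
  enorm (nu - nu0) <= r0 -> Phi_of nu0 i j != 0 -> Phi_of nu i j != 0.
Proof.
(* Absent edges impose nothing and get the default value 1. *)
pose f (ij : 'I_p * 'I_p) := let x := `|Phi_of nu0 ij.1 ij.2| in
  if x == 0 then 1 else x / 2.
have [|r r0 rf] := @fin_pos_lb R _ f.
  move=> ij; rewrite /f; case: eqP => // /eqP; rewrite normr_eq0 => x0.
  by rewrite divr_gt0// normr_gt0.
exists r => // nu i j nur P0; apply/eqP => P.
have ij : i != j by apply: contraNneq P0 => ->; rewrite mxE eqxx.
have := entry_le_enorm (chol nu - chol nu0) i j; rewrite enorm_cholB.
have -> : (chol nu - chol nu0) i j = Phi_of nu0 i j.
  rewrite [LHS]mxE [X in _ + X]mxE !cholE (negbTE ij).
  by move: P; rewrite !mxE (negbTE ij) => ->; rewrite oppr0 sub0r opprK.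
move=> le1; have := rf (i, j); rewrite /f /= normr_eq0 (negbTE P0) => le2.
have := normr_gt0 (Phi_of nu0 i j); rewrite P0 => x0.
by have := le_trans le1 (le_trans nur le2); lra.
Qed.

(* The score of the population likelihood vanishes on every linear space of
   DAGs through [nu0]: since [Sigma0 *m B0] is the transposed inverse of [B0],
   it is triangular the other way round, with diagonal [1 / rho0]. *)
Lemma population_score nu : dag_space nu ->
  (forall i j, Phi_of nu0 i j != 0 -> Phi_of nu i j != 0) ->
  \tr ((chol nu - B0)^T *m (Sigma0 *m B0)) =
  \sum_j (rho_of nu 0 j - rho_of nu0 0 j) / rho_of nu0 0 j.
Proof.
move=> /dag_spaceP[dag rho0] supp; have [/dag_spaceP[dag0 rho00] _] := hnu0.
have [h hP] := dag_rank dag.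
(* A topological order of [nu] also orders the smaller support of [nu0]. *)
have hP0 i j : Phi_of nu0 i j != 0 -> (h i < h j)%N by move=> /supp /hP.
have MI := tr_inverse_diag rho00 hP0 chol_inverse.
have [Ssym _] := Spos.
set H := chol nu - B0.
have -> : Sigma0 *m B0 = M^T by rewrite /M trmx_mul trmxK Ssym.
rewrite -trmx_mul mxtrace_tr /mxtrace; apply: eq_bigr => i _.
rewrite mxE (bigD1 i)//= big1 ?addr0.
  have -> : H i i = rho_of nu 0 i - rho_of nu0 0 i.
    by rewrite /H [LHS]mxE [X in _ + X]mxE /B0 !cholE !eqxx !mxE.
  have := MI i i (leqnn _); rewrite eqxx mulrC => E.
  rewrite mulrC; congr (_ * _); apply: (mulIf (x := rho_of nu0 0 i)).
    by rewrite gt_eqF.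
  by rewrite E mulVf// gt_eqF.
(* Off the diagonal, either the edge from k to i is absent from both graphs and H_ki = 0, or k
   precedes i and M_ik = 0. *)
move=> k ki; have [Pki|Pki] := eqVneq (Phi_of nu k i) 0.
  have P0ki : Phi_of nu0 k i = 0.
    by apply/eqP; apply: contraT => /supp; rewrite Pki eqxx.
  suff -> : H k i = 0 by rewrite mulr0.
  rewrite /H [LHS]mxE [X in _ + X]mxE /B0 !cholE (negbTE ki).
  by move: Pki P0ki; rewrite !mxE (negbTE ki) => -> ->; rewrite oppr0 subr0.
have /eqP := MI i k (ltnW (hP _ _ Pki)).
rewrite [i == k]eq_sym (negbTE ki) mulf_eq0 gt_eqF//= => /eqP ->.
by rewrite mul0r.
Qed.

(** The trace is expanded at [B0]. The population part of its linear term cancels the first-order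
    bound on the logarithms, the rest of it is of order d |H|, and the quadratic term is
    coercive. *)
Lemma mean_loglik_growth : exists2 lm : R, 0 < lm &
  exists2 K : R, 0 <= K & exists2 d1 : R, 0 < d1 & exists2 r0 : R, 0 < r0 &
  forall S d nu, S^T = S -> d <= d1 ->
    (forall j k, `|(S - Sigma0) j k| <= d) ->
    dag_space nu -> enorm (nu - nu0) <= r0 ->
    mean_loglik S nu <= mean_loglik S nu0
      + K * d * enorm (nu - nu0) - lm * enorm (nu - nu0) ^+ 2.
Proof.
have [mu mu0 [d1 d10 coer]] := covariance_coercive.
have [r0 r00 supp] := support_stable.
pose K : R := (p * p)%:R * (p%:R * enorm B0).
have K0 : 0 <= K by rewrite !mulr_ge0 ?enorm_ge0.
exists (mu / 2); first by rewrite divr_gt0.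
exists K => //; exists d1 => //; exists r0 => // S d nu Ssym dd1 Sd dnu nur.
have Phi_supp i j : Phi_of nu0 i j != 0 -> Phi_of nu i j != 0 by exact: supp.
have score := population_score dnu Phi_supp.
have [_ rho0] := (dag_spaceP nu).1 dnu.
have [/dag_spaceP[_ rho00] _] := hnu0.
set N := enorm (nu - nu0).
pose H := chol nu - B0.
have NE : enorm H = N by rewrite /H /B0 enorm_cholB.
have -> : mean_loglik S nu = \sum_j ln (rho_of nu 0 j) - 2^-1 *
  (\tr (B0^T *m (S *m B0)) + \tr (H^T *m (S *m B0)) *+ 2
    + \tr (H^T *m (S *m H))).
  by rewrite /mean_loglik -tr_quad_add// /H [B0 + _]addrC subrK.
have -> : \tr (H^T *m (S *m B0)) =
    \tr (H^T *m (Sigma0 *m B0)) + \tr (H^T *m ((S - Sigma0) *m B0)).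
  by rewrite -mxtraceD -mulmxDr -mulmxDl [Sigma0 + _]addrC subrK.
rewrite score /mean_loglik -/B0.
have lnle : \sum_j ln (rho_of nu 0 j) <= \sum_j ln (rho_of nu0 0 j)
    + \sum_j (rho_of nu 0 j - rho_of nu0 0 j) / rho_of nu0 0 j.
  rewrite -big_split/=; apply: ler_sum => j _.
  have a0 := rho00 j; have b0 := rho0 j.
  move: (rho_of nu0 0 j) (rho_of nu 0 j) a0 b0 => a b a0 b0.
  rewrite -lerBlDl -ln_div ?posrE//.
  have E : b / a = 1 + (b - a) / a by field; rewrite gt_eqF.
  have ba0 : 0 < b / a by rewrite divr_gt0.
  by rewrite E le_ln1Dx//; move: ba0; rewrite E; lra.
have Sd1 j k : `|(S - Sigma0) j k| <= d1 by rewrite (le_trans (Sd j k)).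
have := coer S Sd1 H; rewrite NE => quad.
have := mxtrace_trmul_le H (mulmx_entry_le Sd (entry_le_enorm B0)).
rewrite ler_norml NE => /andP[lin _].
have KE : K * d * N = (p * p)%:R * (N * (p%:R * (d * enorm B0))).
  by rewrite /K; ring.
rewrite KE; rewrite (_ : mu / 2 * N ^+ 2 = 2^-1 * (mu * N ^+ 2)); last by ring.
by move: lnle quad lin; lra.
Qed.

End likelihood.

(** * Coercivity and penalty increments *)

(** With N the norm of [chol nu], the logarithms contribute at most p N against the loss mu N^2 / 2,
    which settles large N; for bounded N one very small rho drives the sum of logarithms down. *)
Lemma mean_loglik_coercive (R : realType) (p : nat) (Sigma0 : 'M[R]_p)
    (nu0 : 'rV[R]_(p * p)) :
  posdef Sigma0 -> equiv_dags (invmx Sigma0) nu0 ->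
  exists2 d1 : R, 0 < d1 & exists K1 kap : R, [/\ 0 < K1, 0 < kap &
  forall S, (forall j k, `|(S - Sigma0) j k| <= d1) ->
  forall nu : 'rV[R]_(p * p), (forall j, 0 < rho_of nu 0 j) ->
    K1 < enorm (nu - nu0) \/ (exists j, rho_of nu 0 j < kap) ->
    mean_loglik S nu < mean_loglik S (nu_of 0 (const_mx 1))].
Proof.
move=> Spos hnu0; have [mu mu0 [d1 d10 coer]] := covariance_coercive Spos hnu0.
pose b := enorm (chol nu0).
have b0 : 0 <= b by exact: enorm_ge0.
pose E := enorm (1%:M : 'M[R]_p).
pose C := (p * p)%:R * (E * (p%:R * ((enorm Sigma0 + d1) * E))).
have C0 : 0 <= C by rewrite !mulr_ge0 ?addr_ge0 ?enorm_ge0 ?(ltW d10).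
(* [C] bounds the trace at the identity factor for every admissible S. Beyond [K0] >= 1, mu N^2 / 2
   exceeds (p + C) N >= p N + C. *)
pose K0 := 2 * (p%:R + C) / mu + 1.
have K01 : 1 <= K0 by rewrite lerDr divr_ge0 ?mulr_ge0 ?addr_ge0 ?(ltW mu0).
have K00 : 0 <= K0 by rewrite (le_trans _ K01).
(* One logarithm below -(C + p K0 + 1) outweighs the others, whose sum is at most p K0. *)
pose kap := expR (- (C + p%:R * K0 + 1)).
exists d1 => //; exists (2 * (K0 + b)), kap; split.
- by rewrite mulr_gt0// ltr_wpDr// (lt_le_trans _ K01).
- exact: expR_gt0.
move=> S Sd nu rho0 far.
set nu1 := nu_of 0 (const_mx 1).
have dag0 : is_dag (0 : 'M[R]_p) by case=> // i c; rewrite /= rcons_path /= !mxE eqxx andbF.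
have [Phi1 rho1] := @nu_ofK R p 0 (const_mx 1) dag0.
have chol1 : chol nu1 = 1%:M by rewrite /chol Phi1 rho1 subr0 diag_const_mx.
have L1 : - C <= mean_loglik S nu1.
  rewrite /mean_loglik chol1 rho1 big1 ?add0r; last first.
    by move=> j _; rewrite mxE ln1.
  have SE j k : `|S j k| <= enorm Sigma0 + d1.
    have -> : S j k = Sigma0 j k + (S - Sigma0) j k.
      by rewrite !mxE addrCA subrr addr0.
    by rewrite (le_trans (ler_normD _ _))// lerD// entry_le_enorm.
  have := mxtrace_trmul_le 1%:M (mulmx_entry_le SE (entry_le_enorm 1%:M)).
  rewrite -/E -/C ler_norml => /andP[_]; move: (C) (C0) => c c0; lra.
apply: lt_le_trans L1.
set N := enorm (chol nu); have N0 : 0 <= N by exact: enorm_ge0.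
have rhoN j : ln (rho_of nu 0 j) <= N.
  rewrite (le_trans (ltW (ln_sublinear (rho0 j))))//.
  have := entry_le_enorm (chol nu) j j; rewrite cholE eqxx -/N.
  have -> : rho_of nu 0 j = unvec nu j j by rewrite mxE.
  by apply: le_trans; exact: ler_norm.
have LN : mean_loglik S nu <=
    \sum_j ln (rho_of nu 0 j) - 2^-1 * (mu * N ^+ 2).
  by rewrite /mean_loglik lerD2l lerN2 ler_wpM2l ?invr_ge0// coer.
apply: le_lt_trans LN _.
have [NK|KN] := leP N K0; last first.
  have : \sum_j ln (rho_of nu 0 j) <= p%:R * N.
    rewrite mulr_natl -[X in _ <= _ *+ X]card_ord -sumr_const.
    by apply: ler_sum => j _.
  have muN : 2 * (p%:R + C) < mu * N.
    rewrite [mu * N]mulrC -ltr_pdivrMr// (lt_trans _ KN)//.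
    by rewrite /K0 ltrDl.
  have : 2 * (p%:R + C) * N < mu * N * N.
    by rewrite ltr_pM2r// (lt_trans _ KN)// (lt_le_trans _ K01).
  have : C <= C * N by rewrite ler_peMr// ltW// (le_lt_trans K01).
  have -> : mu * N ^+ 2 = mu * N * N by ring.
  have -> : 2 * (p%:R + C) * N = 2 * (p%:R * N) + 2 * (C * N) by ring.
  by move: (mu * N * N) (C * N) (p%:R * N) => x y z; lra.
(* For N <= K0 the distance to [nu0] is below 2 (K0 + b), which leaves only the alternative of a
   small rho. *)
have [k kapk] : exists j, rho_of nu 0 j < kap.
  case: far => // far; exfalso.
  have := enormD_sqr_le (chol nu) (- chol nu0); rewrite enorm_cholB.
  have -> : enorm (- chol nu0) = b.
    rewrite /b /enorm; congr Num.sqrt; apply: eq_bigr => i _.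
    by apply: eq_bigr => j _; rewrite mxE sqrrN.
  rewrite -/N; apply/negP; rewrite -ltNge.
  apply: (@lt_le_trans _ _ ((2 * (K0 + b)) ^+ 2)); last first.
    rewrite lerXn2r ?nnegrE ?enorm_ge0 ?(ltW far)//.
    by rewrite mulr_ge0// addr_ge0.
  have : N ^+ 2 <= K0 ^+ 2 by rewrite lerXn2r ?nnegrE.
  have : 0 <= K0 * b by rewrite mulr_ge0.
  have : 1 <= K0 ^+ 2 by rewrite exprn_ege1.
  have : 0 <= b ^+ 2 by exact: sqr_ge0.
  have -> : (2 * (K0 + b)) ^+ 2 = 4 * K0 ^+ 2 + 8 * (K0 * b) + 4 * b ^+ 2 by ring.
  by move: (N ^+ 2) (K0 ^+ 2) (b ^+ 2) (K0 * b) => x y z t; lra.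
have lnk : ln (rho_of nu 0 k) <= - (C + p%:R * K0 + 1).
  by rewrite -[leRHS]expRK ler_ln ?posrE ?expR_gt0// ltW.
have : \sum_(j | j != k) ln (rho_of nu 0 j) <= p%:R * K0.
  apply: (@le_trans _ _ (\sum_(j < p | j != k) K0)).
    by apply: ler_sum => j _; exact: le_trans (rhoN j) NK.
  rewrite sumr_const mulr_natl ler_wpMn2l//.
  by rewrite -[leqRHS]card_ord max_card.
have : 0 <= mu * N ^+ 2 by rewrite mulr_ge0 ?sqr_ge0 ?(ltW mu0).
rewrite [\sum_(j < p) ln _](bigD1 k)//=.
by move: (p%:R * K0) lnk (mu * N ^+ 2) => x h y; lra.
Qed.

Lemma derivable_increment (R : realType) (f : R -> R) (t0 t d : R) :
  (forall x, `|x - t0| < d -> derivable f x 1) -> `|t - t0| < d ->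
  exists2 c, `|c - t0| <= `|t - t0| &
    f t - f t0 = f^`()%classic c * (t - t0).
Proof.
move=> df td.
have isd x : `|x - t0| < d -> is_derive x (1 : R) f (f^`()%classic x).
  by move=> xd; rewrite derive1E; apply: derivableP; exact: df.
have [tt0|t0t] := leP t t0.
  have H x : x \in `[t, t0] -> `|x - t0| <= `|t - t0|.
    rewrite in_itv/= => /andP[h1 h2].
    by rewrite !ler0_norm ?subr_le0// lerN2 lerD2r.
  have [||c ct E] := @MVT_segment R f f^`()%classic t t0 tt0.
  - move=> x /subset_itv_oo_cc /H h; apply: isd; exact: le_lt_trans h td.
  - apply: derivable_within_continuous => x /H h.
    by apply: df; exact: le_lt_trans h td.
  exists c; first exact: H.
  by rewrite -opprB E -mulrN opprB.
have H x : x \in `[t0, t] -> `|x - t0| <= `|t - t0|.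
  rewrite in_itv/= => /andP[h1 h2].
  by rewrite !ger0_norm ?subr_ge0// ?lerD2r// ltW.
have [||c ct E] := @MVT_segment R f f^`()%classic t0 t (ltW t0t).
- move=> x /subset_itv_oo_cc /H h; apply: isd; exact: le_lt_trans h td.
- apply: derivable_within_continuous => x /H h.
  by apply: df; exact: le_lt_trans h td.
by exists c => //; exact: H.
Qed.

(** The mean value theorem is applied to [q] and then to its derivative at the intermediate
    point. *)
Lemma increment_ge (R : realType) (q : R -> R) (t0 t d eta a : R) :
  (forall x, `|x - t0| < d -> [/\ derivable q x 1,
     derivable q^`()%classic x 1 & `|q^`(2)%classic x| <= eta]) ->
  `|t - t0| < d -> `|q^`()%classic t0| <= a ->
  q t0 - (a * `|t - t0| + eta * `|t - t0| ^+ 2) <= q t.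
Proof.
move=> dq td qa.
have [|//|c ct qE] := @derivable_increment _ q t0 t d.
  by move=> x /dq[].
have cd := le_lt_trans ct td.
have [|//|c' ct' q'E] := @derivable_increment _ q^`()%classic t0 c d.
  by move=> x /dq[].
have [_ _ eta'] := dq c' (le_lt_trans ct' cd).
have q2E : q^`()%classic^`()%classic c' = q^`(2)%classic c' by [].
have q'c : `|q^`()%classic c| <= a + eta * `|t - t0|.
  have -> : q^`()%classic c = q^`()%classic t0 + q^`(2)%classic c' * (c - t0).
    by rewrite -q2E -q'E addrC subrK.
  by rewrite (le_trans (ler_normD _ _))// lerD// normrM ler_pM.
have : `|q t - q t0| <= (a + eta * `|t - t0|) * `|t - t0|.
  by rewrite qE normrM ler_wpM2r.
rewrite ler_norml => /andP[+ _].
have -> : (a + eta * `|t - t0|) * `|t - t0| =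
  a * `|t - t0| + eta * `|t - t0| ^+ 2 by ring.
by lra.
Qed.

(** Convergence of b_n controls the second derivative only at [t0]; equicontinuity extends the bound
    to a neighbourhood whose radius does not depend on n. *)
Lemma equi_C2_bound (R : realType) (q : nat -> R -> R) (t0 eta : R) :
  equi_C2_at q t0 -> 0 < eta ->
  (\forall n \near \oo, `|(q n)^`(2)%classic t0| <= eta / 2) ->
  exists2 d : R, 0 < d & \forall n \near \oo, forall x, `|x - t0| < d ->
    [/\ derivable (q n) x 1, derivable (q n)^`()%classic x 1
      & `|(q n)^`(2)%classic x| <= eta].
Proof.
move=> qC2 eta0 qb; have e20 : 0 < eta / 2 by rewrite divr_gt0.
have [[A B] /= [Aoo Bt0] AB] := qC2 _ e20.
have [d /= d0 dB] := Bt0.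
exists d => //; near=> n => x xd.
have An : A n by near: n.
have Bx : B x by apply: dB; rewrite /ball_/= distrC.
have [d1 d2 d3] := AB (n, x) (conj An Bx); split => //.
have qn : `|(q n)^`(2)%classic t0| <= eta / 2 by near: n.
rewrite -[X in `|X|](subrK ((q n)^`(2)%classic t0)).
by rewrite (le_trans (ler_normD _ _))//; move: d3 qn => /=; lra.
Unshelve. all: by end_near. Qed.

(** Entries that vanish at [nu0] can only raise the penalty, by monotonicity; the others obey the
    second-order bound with slope at most a_n. *)
Lemma total_penalty_growth (R : realType) (p : nat) (q : nat -> R -> R)
    (nu0 : 'rV[R]_(p * p)) (eta : R) :
  (forall n, is_penalty (q n)) ->
  (forall i j : 'I_p, Phi_of nu0 i j != 0 -> equi_C2_at q `|Phi_of nu0 i j|) ->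
  b_seq q nu0 n @[n --> \oo] --> (0 : R) -> 0 < eta ->
  exists2 r1 : R, 0 < r1 & \forall n \near \oo, forall nu : 'rV[R]_(p * p),
    enorm (nu - nu0) < r1 ->
    total_penalty (q n) nu0 - (p * p)%:R *
      (a_seq q nu0 n * enorm (nu - nu0) + eta * enorm (nu - nu0) ^+ 2)
    <= total_penalty (q n) nu.
Proof.
move=> qpen hreg hb eta0.
have eta20 : 0 < eta / 2 by rewrite divr_gt0.
have bsmall : \forall n \near \oo, b_seq q nu0 n <= eta / 2.
  near=> n; apply: ltW; near: n; exact: (cvgr_lt _ hb).
have /choice[dl Hdl] : forall ij : 'I_p * 'I_p, exists d : R, 0 < d /\
    (Phi_of nu0 ij.1 ij.2 != 0 -> \forall n \near \oo,
     forall x, `|x - `|Phi_of nu0 ij.1 ij.2| | < d ->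
    [/\ derivable (q n) x 1, derivable (q n)^`()%classic x 1
      & `|(q n)^`(2)%classic x| <= eta]).
  move=> ij; have [_|P0] := eqVneq (Phi_of nu0 ij.1 ij.2) 0; first by exists 1.
  have [|d d0 Hd] := equi_C2_bound (hreg _ _ P0) eta0; last by exists d.
  near=> n; apply: (@le_trans _ _ (b_seq q nu0 n)); last by near: n.
  exact: (le_bigmax_cond (j := ij) 0
    (fun ij => `|(q n)^`(2)%classic `|Phi_of nu0 ij.1 ij.2| |) P0).
have [r1 r10 rdl] := fin_pos_lb (fun ij => (Hdl ij).1).
have C2 : \forall n \near \oo, forall ij : 'I_p * 'I_p,
    Phi_of nu0 ij.1 ij.2 != 0 -> forall x, `|x - `|Phi_of nu0 ij.1 ij.2| | < dl ij ->
    [/\ derivable (q n) x 1, derivable (q n)^`()%classic x 1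
      & `|(q n)^`(2)%classic x| <= eta].
  apply: filter_forall => ij.
  have [P0|P0] := eqVneq (Phi_of nu0 ij.1 ij.2) 0.
    by apply: nearW => n.
  by have := (Hdl ij).2 P0; apply: filterS => n Hn _.
exists r1 => //; near=> n => nu nur.
have C2n : forall ij : 'I_p * 'I_p,
    Phi_of nu0 ij.1 ij.2 != 0 -> forall x, `|x - `|Phi_of nu0 ij.1 ij.2| | < dl ij ->
    [/\ derivable (q n) x 1, derivable (q n)^`()%classic x 1
      & `|(q n)^`(2)%classic x| <= eta] by near: n.
set N := enorm (nu - nu0) in nur *.
have N0 : 0 <= N by exact: enorm_ge0.
set a := a_seq q nu0 n.
have a0 : 0 <= a by exact: bigmax_ge_id.
set c := a * N + eta * N ^+ 2.
have c0 : 0 <= c by rewrite addr_ge0 ?mulr_ge0 ?sqr_ge0 ?(ltW eta0).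
have [q0 qmono _] := qpen n.
have term i j : i != j -> q n `|unvec nu0 i j| - c <= q n `|unvec nu i j|.
  move=> ij.
  have uN : `|unvec nu i j - unvec nu0 i j| <= N.
    have := entry_le_enorm (nu - nu0) 0 (mxvec_index j i).
    by rewrite !unvecE !mxE.
  have PE : Phi_of nu0 i j = unvec nu0 i j by rewrite mxE (negbTE ij).
  have [P0|P0] := eqVneq (Phi_of nu0 i j) 0.
    rewrite -PE P0 normr0 (@le_trans _ _ (q n 0))//; last exact: qmono.
    by rewrite gerBl.
  have tN : `| `|unvec nu i j| - `|unvec nu0 i j| | <= N.
    exact: le_trans (ler_dist_dist _ _) uN.
  have tdl : `| `|unvec nu i j| - `|unvec nu0 i j| | < dl (i, j).
    by rewrite (le_lt_trans tN)// (lt_le_trans nur).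
  have := C2n (i, j) P0; rewrite /= PE => C2ij.
  have qa : `|(q n)^`()%classic `|unvec nu0 i j| | <= a.
    rewrite -PE; exact: (le_bigmax_cond (j := (i, j)) 0
      (fun ij => `|(q n)^`()%classic `|Phi_of nu0 ij.1 ij.2| |) P0).
  apply: le_trans (increment_ge C2ij tdl qa).
  rewrite lerD2l lerN2 lerD//.
    by rewrite ler_wpM2l.
  by rewrite ler_wpM2l ?(ltW eta0)// lerXn2r ?nnegrE.
have : \sum_i \sum_(j | i != j) (q n `|unvec nu0 i j| - c) <=
    total_penalty (q n) nu.
  by apply: ler_sum => i _; apply: ler_sum => j; exact: term.
apply: le_trans.
have -> : \sum_i \sum_(j | i != j) (q n `|unvec nu0 i j| - c) =
    total_penalty (q n) nu0 - \sum_(i < p) \sum_(j < p | i != j) c.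
  by rewrite /total_penalty -sumrB; apply: eq_bigr => i _; rewrite sumrB.
rewrite lerD2l lerN2.
rewrite natrM -mulrA mulr_natl -[X in _ <= _ *+ X]card_ord -sumr_const.
apply: ler_sum => i _; rewrite sumr_const mulr_natl ler_wpMn2l//.
by rewrite -[leqRHS]card_ord max_card.
Unshelve. all: by end_near. Qed.

(** * Semicontinuity and compactness *)

(** Upper semicontinuity is the right notion here: a penalty may jump upwards at 0, so the objective
    can be discontinuous where an edge vanishes. *)
Definition usc_at (R : realType) (T : topologicalType) (f : T -> R) (x : T) :=
  forall e : R, 0 < e -> \forall y \near x, f y <= f x + e.

Lemma seq_argmax (R : realType) (T : eqType) (f : T -> R) (s : seq T) (x : T) :
  x \in s -> exists2 y, y \in s & forall z, z \in s -> f z <= f y.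
Proof.
elim: s x => // a s IH x _; case: s IH => [|b s] IH.
  by exists a; rewrite ?mem_head// => z; rewrite inE => /eqP ->.
have [y ys ymax] := IH b (mem_head _ _).
have [ay|ya] := leP (f a) (f y).
  exists y; first by rewrite inE ys orbT.
  by move=> z; rewrite inE => /predU1P[->//|/ymax].
exists a; first exact: mem_head.
move=> z; rewrite inE => /predU1P[->//|/ymax zy].
exact: le_trans zy (ltW ya).
Qed.

(** Without a maximum, the interiors of the sets f < f y cover [K]; the y of largest value in a
    finite subcover would lie in one of them. *)
Lemma usc_compact_max (R : realType) (T : ptopologicalType) (f : T -> R)
    (K : set T) :
  compact K -> K !=set0 -> (forall x, K x -> usc_at f x) ->
  exists2 x, K x & forall y, K y -> f y <= f x.
Proof.
rewrite compact_cover => Kc [x0 Kx0] fusc; apply: contrapT => nomax.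
have {}nomax x : K x -> exists2 y, K y & f x < f y.
  move=> Kx; apply: contrapT => H; apply: nomax; exists x => // y Ky.
  by rewrite leNgt; apply/negP => xy; apply: H; exists y.
pose U y := [set x | f x < f y]^°.
have [||D DK cov] := Kc _ K U.
- by move=> y _; exact: open_interior.
- move=> x Kx; have [y Ky xy] := nomax x Kx; exists y => //.
  have e0 : 0 < (f y - f x) / 2 by rewrite divr_gt0// subr_gt0.
  have := fusc x Kx _ e0; apply: filterS => z /=; move: xy; lra.
have [y0 Dy0 _] := cov _ Kx0.
have [y1 Dy1 y1max] := seq_argmax f Dy0.
have K1 : K y1 by have := DK _ Dy1; rewrite inE.
have [y Dy /interior_subset /=] := cov _ K1.
by rewrite ltNge y1max.
Qed.

Lemma usc_atD (R : realType) (T : topologicalType) (f g : T -> R) (x : T) :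
  usc_at f x -> usc_at g x -> usc_at (fun y => f y + g y) x.
Proof.
move=> fx gx e e0; have e20 : 0 < e / 2 by rewrite divr_gt0.
by apply: filterS2 (fx _ e20) (gx _ e20) => y; lra.
Qed.

Lemma usc_at_sum (R : realType) (T : topologicalType) (I : Type) (r : seq I)
    (Pr : pred I) (F : I -> T -> R) (x : T) :
  (forall i, Pr i -> usc_at (F i) x) ->
  usc_at (fun y => \sum_(i <- r | Pr i) F i y) x.
Proof.
move=> FU; elim: r => [|i r IH].
  move=> e e0; apply: nearW => y; rewrite !big_nil add0r; exact: ltW.
have [Pi|nPi] := boolP (Pr i); last first.
  move=> e e0; have := IH e e0; apply: filterS => y.
  by rewrite !big_cons (negbTE nPi).
move=> e e0; have := usc_atD (FU i Pi) IH e0; apply: filterS => y.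
by rewrite !big_cons Pi.
Qed.

Lemma continuous_usc_at (R : realType) (T : topologicalType) (f : T -> R)
    (x : T) : {for x, continuous f} -> usc_at f x.
Proof.
move=> fx e e0; near=> y; apply: ltW; near: y.
by apply: (cvgr_lt _ fx); rewrite ltrDl.
Unshelve. all: by end_near. Qed.

Lemma usc_at_max (R : realType) (T : topologicalType) (f : T -> R) (x : T) :
  (forall y, f y <= f x) -> usc_at f x.
Proof.
by move=> fx e e0; apply: nearW => y; rewrite (le_trans (fx y))// lerDl ltW.
Qed.

Lemma near_forall_neq0 (R : realType) (T : topologicalType) (I : finType)
    (f : I -> T -> R) (x : T) : (forall i, continuous (f i)) ->
  \forall y \near x, forall i, f i x != 0 -> f i y != 0.
Proof.
move=> cf; apply: filter_forall => i.
have [f0|f0] := eqVneq (f i x) 0; first by apply: nearW.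
have cn : {for x, continuous (fun y => `|f i y|)}.
  by apply: (continuous_comp (cf i x)); exact: norm_continuous.
have := cvgr_gt _ cn 0; rewrite normr_gt0 => /(_ _ f0).
by apply: filterS => y; rewrite normr_gt0.
Qed.

Lemma near_lt_continuous_sqr (R : realType) (T : topologicalType) (g : T -> R)
    (x : T) (r : R) :
  (forall y, 0 <= g y) -> continuous (fun y => g y ^+ 2) -> g x < r ->
  \forall y \near x, g y < r.
Proof.
move=> g0 cg gr; have r0 : 0 < r by rewrite (le_lt_trans _ gr).
have h : g x ^+ 2 < r ^+ 2 by rewrite ltrXn2r// ?nnegrE// ltW.
have : \forall y \near x, g y ^+ 2 < r ^+ 2 by apply: (cvgr_lt _ (cg x)).
apply: filterS => y; rewrite !ltNge; apply: contra => ry.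
by rewrite lerXn2r ?nnegrE// ltW.
Qed.

(** * Continuity of the coordinates and closed sets of DAGs *)

Section topology_of_dags.
Variables (R : realType) (p : nat).
Implicit Types (nu : 'rV[R]_(p * p)).

Lemma continuous_unvec (i j : 'I_p) :
  continuous (fun nu : 'rV[R]_(p * p) => unvec nu i j).
Proof.
rewrite (_ : (fun _ => _) = (fun nu : 'rV[R]_(p * p) => nu 0 (mxvec_index j i))).
  exact: coord_continuous.
by apply/funext => nu; rewrite unvecE.
Qed.

Lemma continuous_rho_of (j : 'I_p) :
  continuous (fun nu : 'rV[R]_(p * p) => rho_of nu 0 j).
Proof.
rewrite (_ : (fun _ => _) = (fun nu : 'rV[R]_(p * p) => unvec nu j j)).
  exact: continuous_unvec.
by apply/funext => nu; rewrite mxE.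
Qed.

Lemma continuous_Phi_of (i j : 'I_p) :
  continuous (fun nu : 'rV[R]_(p * p) => Phi_of nu i j).
Proof.
rewrite (_ : (fun _ => _) =
    (fun nu : 'rV[R]_(p * p) => if i == j then 0 else unvec nu i j)).
  by case: eqP => _; [exact: cst_continuous|exact: continuous_unvec].
by apply/funext => nu; rewrite mxE.
Qed.

Lemma continuous_chol (i j : 'I_p) :
  continuous (fun nu : 'rV[R]_(p * p) => chol nu i j).
Proof.
rewrite (_ : (fun _ => _) = (fun nu : 'rV[R]_(p * p) =>
    if i == j then unvec nu i j else - unvec nu i j)).
  case: eqP => _; first exact: continuous_unvec.
  by move=> nu; apply: continuousN; exact: continuous_unvec.
by apply/funext => nu; rewrite cholE.
Qed.

Lemma continuous_sqr (T : topologicalType) (f : T -> R) :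
  continuous f -> continuous (fun x => f x ^+ 2).
Proof.
move=> cf; rewrite (_ : (fun _ => _) = (fun x => f x * f x)).
  by move=> x; apply: continuousM; exact: cf.
by apply/funext => x; rewrite expr2.
Qed.

Lemma continuous_enormB_sqr (nu0 : 'rV[R]_(p * p)) :
  continuous (fun nu => enorm (nu - nu0) ^+ 2).
Proof.
rewrite (_ : (fun _ => _) = (fun nu : 'rV[R]_(p * p) =>
    \sum_i \sum_j (chol nu i j - chol nu0 i j) ^+ 2)).
  apply: continuous_sumr => i _; apply: continuous_sumr => j _.
  apply: continuous_sqr => nu; apply: continuousB.
    exact: continuous_chol.
  exact: cst_continuous.
apply/funext => nu; rewrite -enorm_cholB enorm_sqr.
by apply: eq_bigr => i _; apply: eq_bigr => j _; rewrite !mxE.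
Qed.

Lemma loglik_chol n (X : 'M[R]_(n, p)) nu : loglik X nu =
  \sum_j (n%:R * ln (rho_of nu 0 j)
    - 2^-1 * \sum_i (\sum_k X i k * chol nu k j) ^+ 2).
Proof.
apply: eq_bigr => j _; congr (_ - _ * _); rewrite enorm_sqr.
apply: eq_bigr => i _; rewrite big_ord1; congr (_ ^+ 2).
have -> : \sum_k X i k * chol nu k j = (X *m chol nu) i j by rewrite mxE.
rewrite /chol mulmxBr mul_mx_diag !mxE mulrC.
by congr (_ - _); apply: eq_bigr => k _; rewrite !mxE.
Qed.

(** Each penalty term is continuous where its entry is nonzero; where the entry is zero, minus the
    penalty is at its maximum. *)
Lemma penalized_loglik_usc n (q : R -> R) (X : 'M[R]_(n, p)) nu :
  is_penalty q -> (forall j, 0 < rho_of nu 0 j) ->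
  usc_at (penalized_loglik q X) nu.
Proof.
move=> [q0 qmono qcont] rho0.
rewrite (_ : penalized_loglik q X = (fun nu => loglik X nu +
    \sum_i \sum_(j | i != j) - (n%:R * q `|unvec nu i j|))); last first.
  apply/funext => y; rewrite /penalized_loglik /total_penalty mulr_sumr -sumrN.
  by congr (_ + _); apply: eq_bigr => i _; rewrite mulr_sumr -sumrN.
apply: usc_atD.
  rewrite (_ : loglik X = (fun nu => \sum_j (n%:R * ln (rho_of nu 0 j)
    - 2^-1 * \sum_i (\sum_k X i k * chol nu k j) ^+ 2))); last first.
    by apply/funext => y; exact: loglik_chol.
  apply: usc_at_sum => j _; apply: continuous_usc_at; apply: continuousB.
    apply: continuousM; first exact: cst_continuous.
    apply: (@continuous_comp _ _ _ (fun y : 'rV[R]_(p * p) => rho_of y 0 j) (@ln R)).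
      exact: continuous_rho_of.
    exact: continuous_ln.
  apply: continuousM; first exact: cst_continuous.
  apply: continuous_sumr => i _; apply: continuous_sqr.
  apply: continuous_sumr => k _ y; apply: continuousM; first exact: cst_continuous.
  exact: continuous_chol.
apply: usc_at_sum => i _; apply: usc_at_sum => j _.
have cu := @continuous_unvec i j.
have [u0|u0] := eqVneq (unvec nu i j) 0.
  apply: usc_at_max => y; rewrite u0 normr0.
  by rewrite lerN2 ler_wpM2l// qmono.
apply: continuous_usc_at; apply: continuousN; apply: continuousM.
  exact: cst_continuous.
apply: (@continuous_comp _ _ _ (fun y : 'rV[R]_(p * p) => `|unvec y i j|) q).
  apply: (@continuous_comp _ _ _ (fun y : 'rV[R]_(p * p) => unvec y i j) Num.norm).
    exact: cu.
  exact: norm_continuous.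
by apply: qcont; rewrite normr_gt0.
Qed.

(** The bound [kap] replaces positivity of rho, which is not a closed condition. *)
Definition dag_box (nu0 : 'rV[R]_(p * p)) (kap r : R) : set 'rV[R]_(p * p) :=
  [set nu | [/\ is_dag (Phi_of nu), forall j, kap <= rho_of nu 0 j
    & enorm (nu - nu0) <= r]].

(** Acyclicity is closed: nonzero entries of a limit stay nonzero nearby, so a cycle of the limit
    would already occur in the box. *)
Lemma dag_box_compact nu0 kap r : 0 <= r -> compact (dag_box nu0 kap r).
Proof.
move=> r0; apply: bounded_closed_compact.
  exists (enorm nu0 + r); split; first exact: num_real.
  move=> c rc nu [_ _ nur] /=; apply: le_trans (ltW rc).
  rewrite [`|nu|]mx_normrE; apply/bigmax_leP; split => [|[i k] _ /=].
    by rewrite addr_ge0// enorm_ge0.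
  rewrite -[nu i k](subrK (nu0 i k)) addrC (le_trans (ler_normD _ _))// lerD//.
    exact: entry_le_enorm.
  apply: le_trans nur; have := entry_le_enorm (nu - nu0) i k.
  by rewrite !mxE.
move=> nu cl; split.
- move=> c Phic; apply: contrapT => c0.
  have [y [[dy _ _]]] : dag_box nu0 kap r `&` [set y | forall ij : 'I_p * 'I_p,
      Phi_of nu ij.1 ij.2 != 0 -> Phi_of y ij.1 ij.2 != 0] !=set0.
    apply: cl; apply: (near_forall_neq0 (f := fun ij nu => Phi_of nu ij.1 ij.2)).
    by move=> ij; exact: continuous_Phi_of.
  move=> supp; apply: c0; apply: dy; move: Phic.
  by apply: sub_cycle => i j; exact: (supp (i, j)).
- move=> j; rewrite leNgt; apply/negP => rk.
  have [y [[_ ky _] /=]] : dag_box nu0 kap r `&` [set y | rho_of y 0 j < kap] !=set0.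
    by apply: cl; apply: (cvgr_lt _ (@continuous_rho_of j nu)).
  by rewrite ltNge ky.
- rewrite leNgt; apply/negP => rN.
  have rN2 : r ^+ 2 < enorm (nu - nu0) ^+ 2.
    by rewrite ltrXn2r// nnegrE enorm_ge0.
  have [y [[_ _ yr] /=]] : dag_box nu0 kap r `&`
      [set y | r ^+ 2 < enorm (y - nu0) ^+ 2] !=set0.
    by apply: cl; apply: (cvgr_gt _ (@continuous_enormB_sqr nu0 nu)).
  by rewrite ltNge lerXn2r ?nnegrE ?enorm_ge0.
Qed.

Lemma near_enormB_lt nu0 nu r : enorm (nu - nu0) < r ->
  \forall y \near nu, enorm (y - nu0) < r.
Proof.
move=> h.
apply: (@near_lt_continuous_sqr R _ (fun y : 'rV[R]_(p * p) => enorm (y - nu0)) nu r _ _ h).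
  by move=> y; exact: enorm_ge0.
exact: continuous_enormB_sqr.
Qed.

End topology_of_dags.

(** * Existence of maximizers *)

Section deterministic.
Variables (R : realType) (p : nat).
Variables (Sigma0 : 'M[R]_p) (nu0 : 'rV[R]_(p * p)).
Hypotheses (Spos : posdef Sigma0) (hnu0 : equiv_dags (invmx Sigma0) nu0).

Lemma penalized_loglikE n (q : R -> R) (X : 'M[R]_(n, p)) nu : (0 < n)%N ->
  penalized_loglik q X nu = n%:R *
    (mean_loglik (n%:R^-1 *: (X^T *m X)) nu - total_penalty q nu).
Proof. by move=> n0; rewrite /penalized_loglik loglikE// [RHS]mulrBr. Qed.

Lemma dag_boxW kap r : 0 < kap ->
  dag_box nu0 kap r `<=` @dag_space R p.
Proof.
move=> kap0 nu [dag kapr _]; apply/dag_spaceP; split => // j.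
exact: lt_le_trans kap0 (kapr j).
Qed.

Lemma penalized_loglik_box_max n (q : R -> R) (X : 'M[R]_(n, p)) kap r nu :
  is_penalty q -> 0 < kap -> 0 <= r -> dag_box nu0 kap r nu ->
  exists2 x, dag_box nu0 kap r x & forall y, dag_box nu0 kap r y ->
    penalized_loglik q X y <= penalized_loglik q X x.
Proof.
move=> qpen kap0 r0 Knu; apply: usc_compact_max.
- exact: dag_box_compact.
- by exists nu.
- move=> x /(dag_boxW kap0)/dag_spaceP[_ rho0].
  exact: penalized_loglik_usc.
Qed.

(** The condition on [kap + r] puts every DAG of the ball into the compact box, so a box maximizer
    inside the open ball is a local maximizer. *)
Lemma local_maximizer_in_ball n (q : R -> R) (X : 'M[R]_(n, p)) kap r :
  is_penalty q -> 0 < kap -> (forall j, kap + r <= rho_of nu0 0 j) -> 0 < r ->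
  (forall nu, dag_space nu -> enorm (nu - nu0) = r ->
    penalized_loglik q X nu <= penalized_loglik q X nu0) ->
  exists2 nu, local_maximizer (@dag_space R p) (penalized_loglik q X) nu
    & enorm (nu - nu0) <= r.
Proof.
move=> qpen kap0 kapr r0 sphere.
have [dag0 rho00] := (dag_spaceP nu0).1 hnu0.1.
have K0 : dag_box nu0 kap r nu0.
  split => //; last by rewrite subrr enorm0 ltW.
  by move=> j; apply: le_trans (kapr j); rewrite lerDl ltW.
have inbox nu : dag_space nu -> enorm (nu - nu0) <= r -> dag_box nu0 kap r nu.
  move=> /dag_spaceP[dag _] nur; split => // j.
  have := le_trans (entry_le_enorm (chol nu - chol nu0) j j).
  rewrite enorm_cholB => /(_ _ nur).
  have -> : (chol nu - chol nu0) j j = rho_of nu 0 j - rho_of nu0 0 j.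
    by rewrite [LHS]mxE [X in _ + X]mxE !cholE eqxx !mxE.
  by rewrite ler_norml => /andP[+ _]; have := kapr j; lra.
have locmax x : dag_box nu0 kap r x -> enorm (x - nu0) < r ->
    (forall y, dag_box nu0 kap r y ->
      penalized_loglik q X y <= penalized_loglik q X x) ->
    local_maximizer (@dag_space R p) (penalized_loglik q X) x.
  move=> Kx xr xmax; split; first exact: dag_boxW Kx.
  have := near_enormB_lt xr; apply: filterS => y yr Dy.
  by apply/xmax/inbox => //; exact: ltW.
have [x Kx xmax] := penalized_loglik_box_max X qpen kap0 (ltW r0) K0.
(* If the box maximizer lies on the sphere, [nu0] does at least as well and is itself a maximizer,
   at the centre of the ball. *)
have [_ _] := Kx; rewrite le_eqVlt => /predU1P[xr|xr].
  exists nu0; last by rewrite subrr enorm0 ltW.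
  apply: locmax => //; first by rewrite subrr enorm0.
  move=> y /xmax /le_trans; apply; apply: sphere => //.
  exact: dag_boxW Kx.
by exists x; [exact: locmax|exact: ltW].
Qed.

(** Outside the box the likelihood is below its value at (0, 1), where the penalty is smallest, so
    the box maximizer is global whatever the penalty. *)
Lemma global_maximizer n (q : R -> R) (X : 'M[R]_(n, p)) K1 kap :
  (0 < n)%N -> is_penalty q -> 0 < K1 -> 0 < kap ->
  (forall nu : 'rV[R]_(p * p), (forall j, 0 < rho_of nu 0 j) ->
    K1 < enorm (nu - nu0) \/ (exists j, rho_of nu 0 j < kap) ->
    mean_loglik (n%:R^-1 *: (X^T *m X)) nu <
    mean_loglik (n%:R^-1 *: (X^T *m X)) (nu_of 0 (const_mx 1))) ->
  exists2 nu, local_maximizer (@dag_space R p) (penalized_loglik q X) nu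
    & enorm (nu - nu0) <= K1.
Proof.
move=> n0 qpen K10 kap0 far.
set nu1 := nu_of 0 (const_mx 1) in far.
have dag1 : is_dag (0 : 'M[R]_p).
  by case=> // i c; rewrite /= rcons_path /= !mxE eqxx andbF.
have [Phi1 rho1] := @nu_ofK R p 0 (const_mx 1) dag1.
have rho10 j : 0 < rho_of nu1 0 j by rewrite rho1 mxE.
have box nu : dag_space nu -> ~ dag_box nu0 kap K1 nu ->
    K1 < enorm (nu - nu0) \/ (exists j, rho_of nu 0 j < kap).
  move=> /dag_spaceP[dag _] nbox; apply: contrapT => /not_orP[nK nkap].
  apply: nbox; split => //; last by rewrite leNgt; apply/negP.
  by move=> j; rewrite leNgt; apply/negP => jk; apply: nkap; exists j.
have D1 : dag_space nu1 by apply/dag_spaceP; rewrite Phi1.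
have K1box : dag_box nu0 kap K1 nu1.
  by apply: contrapT => /(box _ D1)/(far _ rho10); rewrite ltxx.
have [x Kx xmax] := penalized_loglik_box_max X qpen kap0 (ltW K10) K1box.
exists x; last by have [] := Kx.
split; first exact: dag_boxW Kx.
have H y : dag_space y -> penalized_loglik q X y <= penalized_loglik q X x.
  move=> Dy; have [Ky|nKy] := pselect (dag_box nu0 kap K1 y); first exact: xmax.
  apply: le_trans (xmax _ K1box); rewrite !penalized_loglikE//.
  have [_ rhoy] := (dag_spaceP y).1 Dy.
  rewrite ler_wpM2l// lerB//; first exact: ltW (far _ rhoy (box _ Dy nKy)).
  have [_ qmono _] := qpen.
  apply: ler_sum => i _; apply: ler_sum => j ij.
  have -> : unvec nu1 i j = 0.
    by have := congr1 (fun A : 'M[R]_p => A i j) Phi1; rewrite !mxE (negbTE ij).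
  by rewrite normr0; apply: qmono.
by have := near_enormB_lt (nu0 := x) (nu := x) (r := 1); rewrite subrr enorm0 =>
  /(_ ltr01); apply: filterS => y _; exact: H.
Qed.

Lemma near_infty_div_sqrt_le (M d : R) : 0 < d ->
  \forall n \near \oo, M / Num.sqrt n%:R <= d.
Proof.
move=> d0; near=> n.
have n0 : (0 < n)%N by near: n; exact: nbhs_infty_gt.
have r0 : 0 < Num.sqrt n%:R :> R by rewrite sqrtr_gt0 ltr0n.
rewrite ler_pdivrMr// -ler_pdivrMl// (le_trans (ler_norm _))//.
rewrite -sqrtr_sqr ler_wsqrtr//.
by near: n; exact: nbhs_infty_ger.
Unshelve. all: by end_near. Qed.

(** This is the deterministic core: randomness enters only through the bound on the covariance
    error, and [C] is fixed before n and X. *)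
Lemma penalized_mle_exists (q : nat -> R -> R) (M : R) :
  (forall n, is_penalty (q n)) ->
  (forall i j : 'I_p, Phi_of nu0 i j != 0 -> equi_C2_at q `|Phi_of nu0 i j|) ->
  b_seq q nu0 n @[n --> \oo] --> (0 : R) -> 0 < M ->
  exists C : R, \forall n \near \oo, forall X : 'M[R]_(n, p),
    (forall j k, `|(n%:R^-1 *: (X^T *m X) - Sigma0) j k|
       <= M / Num.sqrt n%:R) ->
    exists2 nu, local_maximizer (@dag_space R p) (penalized_loglik (q n) X) nu
      & enorm (nu - nu0) <= C * ((Num.sqrt n%:R)^-1 + a_seq q nu0 n).
Proof.
move=> qpen hreg hb M0.
have [lm lm0 [K K0 [d1 d10 [r0 r00 growth]]]] := mean_loglik_growth Spos hnu0.
have [d2 d20 [K1 [kap [K10 kap0 coer]]]] := mean_loglik_coercive Spos hnu0.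
pose pp : R := (p * p)%:R.
have pp0 : 0 <= pp by [].
(* This makes the quadratic loss from the penalty at most half of the curvature [lm]. *)
pose eta := lm / (2 * (pp + 1)).
have eta0 : 0 < eta by rewrite divr_gt0// mulr_gt0// ltr_wpDl.
have ppeta : pp * eta <= lm / 2.
  have -> : pp * eta = lm / 2 * (pp / (pp + 1)).
    by rewrite /eta; field; rewrite gt_eqF// ltr_wpDl.
  by rewrite ler_piMr ?divr_ge0 ?(ltW lm0)// ler_pdivrMr ?ltr_wpDl// mul1r lerDl.
have [r1 r10 pgrowth] := total_penalty_growth qpen hreg hb eta0.
have [_ rho00] := (dag_spaceP nu0).1 hnu0.1.
have [k0 k00 k0rho] : exists2 k0 : R, 0 < k0 & forall j, k0 <= rho_of nu0 0 j / 2.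
  by apply: fin_pos_lb => j; rewrite divr_gt0.
pose dl := Num.min r0 (Num.min (r1 / 2) k0).
have dl0 : 0 < dl by rewrite !lt_min r00 divr_gt0// k00.
have [dlr0 dlr1 dlk0] : [/\ dl <= r0, dl < r1 & dl <= k0].
  split; first by rewrite ge_min lexx.
    have : dl <= r1 / 2 by rewrite !ge_min lexx orbT.
    by move: r10; lra.
  by rewrite !ge_min lexx !orbT.
(* Chosen so that on the sphere of radius r = C1 (s + a) the linear terms are at most (lm / 2) r^2,
   the other half of the curvature. *)
pose C1 := 2 * (K * M + pp) / lm + 1.
have KM0 : 0 <= K * M by rewrite mulr_ge0// ltW.
have C10 : 0 < C1 by rewrite ltr_wpDl// divr_ge0 ?mulr_ge0 ?addr_ge0 ?(ltW lm0).
have C1lm : K * M + pp <= lm * C1 / 2.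
  have -> : lm * C1 / 2 = K * M + pp + lm / 2.
    by rewrite /C1; field; rewrite gt_eqF.
  by rewrite lerDl divr_ge0// ltW.
(* [C1] serves the case of a small radius. Otherwise C1 (s + a) / dl > 1, and the second summand
   covers the fixed bound [K1] on the global maximizer. *)
exists (C1 + K1 * C1 / dl).
have big1 := near_infty_div_sqrt_le M d10.
have big2 := near_infty_div_sqrt_le M d20.
near=> n => X Sd.
have n0 : (0 < n)%N by near: n; exact: nbhs_infty_gt.
have nd1 : M / Num.sqrt n%:R <= d1 by near: n.
have nd2 : M / Num.sqrt n%:R <= d2 by near: n.
have pg : forall nu : 'rV[R]_(p * p),
    enorm (nu - nu0) < r1 ->
    total_penalty (q n) nu0 - pp *
      (a_seq q nu0 n * enorm (nu - nu0) + eta * enorm (nu - nu0) ^+ 2)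
    <= total_penalty (q n) nu by near: n.
set S := n%:R^-1 *: (X^T *m X) in Sd.
have Ssym : S^T = S by rewrite /S linearZ/= trmx_mul trmxK.
set s := (Num.sqrt n%:R)^-1; set a := a_seq q nu0 n.
have s0 : 0 < s by rewrite invr_gt0 sqrtr_gt0 ltr0n.
have a0 : 0 <= a by exact: bigmax_ge_id.
have al0 : 0 < s + a by rewrite ltr_pwDl.
have [small|large] := leP (C1 * (s + a)) dl.
  pose r := C1 * (s + a).
  have r_gt0 : 0 < r by rewrite mulr_gt0.
  have [nu numax nur] : exists2 nu,
      local_maximizer (@dag_space R p) (penalized_loglik (q n) X) nu
      & enorm (nu - nu0) <= r.
    apply: (@local_maximizer_in_ball _ _ _ k0) => //.
      by move=> j; have := k0rho j; move: small dlk0; rewrite -/r; lra.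
    move=> nu Dnu nur; rewrite !penalized_loglikE// ler_wpM2l// -/S.
    have g1 := growth S _ nu Ssym nd1 Sd Dnu.
    have g2 := pg nu; rewrite nur in g1 g2.
    have {}g1 := g1 (le_trans small dlr0).
    have {}g2 := g2 (le_lt_trans small dlr1).
    rewrite -/s -/a in g1 g2.
    have e1 : K * (M * s) * r + pp * (a * r) <= (K * M + pp) * (s + a) * r.
      rewrite -subr_ge0 (_ : _ - _ = (K * M * a + pp * s) * r); last by ring.
      by rewrite mulr_ge0 ?(ltW r_gt0)// addr_ge0 ?mulr_ge0 ?(ltW s0) ?(ltW M0).
    have e2 : (K * M + pp) * (s + a) * r <= lm / 2 * r ^+ 2.
      have -> : lm / 2 * r ^+ 2 = lm * C1 / 2 * (s + a) * r by rewrite /r; ring.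
      by rewrite !ler_wpM2r// ltW.
    have e3 : pp * eta * r ^+ 2 <= lm / 2 * r ^+ 2.
      by rewrite ler_wpM2r// sqr_ge0.
    have e4 : pp * (a * r + eta * r ^+ 2) = pp * (a * r) + pp * eta * r ^+ 2 by ring.
    rewrite e4 in g2.
    have e5 : lm * r ^+ 2 = lm / 2 * r ^+ 2 + lm / 2 * r ^+ 2 by field.
    rewrite e5 in g1.
    move: g1 g2 e1 e2 e3.
    move: (K * (M * s) * r) (pp * (a * r)) (lm / 2 * r ^+ 2) (pp * eta * r ^+ 2)
      ((K * M + pp) * (s + a) * r) => x1 x2 x3 x4 x5; lra.
  exists nu => //; apply: le_trans nur _.
  by rewrite /r ler_wpM2r ?(ltW al0)// lerDl divr_ge0 ?mulr_ge0// ltW.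
have [|nu numax nuK1] := @global_maximizer n (q n) X K1 kap n0 (qpen n) K10 kap0.
  by move=> nu rho_pos; apply: coer => // j k; exact: le_trans (Sd j k) nd2.
exists nu => //; apply: le_trans nuK1 _.
rewrite mulrDl -[leLHS]add0r lerD//; first by rewrite mulr_ge0 ?(ltW C10) ?(ltW al0).
have -> : K1 * C1 / dl * (s + a) = K1 * (C1 * (s + a) / dl) by ring.
by rewrite ler_peMr ?(ltW K10)// ler_pdivlMr// mul1r ltW.
Unshelve. all: by end_near. Qed.

End deterministic.

(* Taking the least multiple of the rate within which a local maximizer exists
   makes the choice independent of the confidence level. *)
Lemma choose_at_rate (I E : Type) (R : realType) (L : I -> E -> Prop)
    (dist : E -> R) (rate : I -> R) (x0 : E) : (forall i, 0 <= rate i) ->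
  exists xhat : I -> E, forall i (k : nat),
    (exists2 x, L i x & dist x <= k%:R * rate i) ->
    L i (xhat i) /\ dist (xhat i) <= k%:R * rate i.
Proof.
move=> rate0.
suff /choice[xhat xhatP] : forall i, exists x, forall k : nat,
    (exists2 y, L i y & dist y <= k%:R * rate i) ->
    L i x /\ dist x <= k%:R * rate i by exists xhat.
move=> i.
pose Q k := exists2 x, L i x & dist x <= k%:R * rate i.
have [[k Qk]|nQ] := pselect (exists k, Q k); last first.
  by exists x0 => k Qk; exfalso; apply: nQ; exists k.
have ex : exists k, `[< Q k >] by exists k; apply/asboolP.
case: (ex_minnP ex) => k0 /asboolP[x Lx xk0] kmin.
exists x => l Ql; split => //; apply: le_trans xk0 _.
by rewrite ler_wpM2r// ler_nat; apply: kmin; apply/asboolP.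
Qed.

Lemma inner_prob_geS (R : realType) (d : measure_display)
    (T : measurableType d) (P : probability T R) (A B : set T) (c : R) :
  A `<=` B -> inner_prob_ge P A c -> inner_prob_ge P B c.
Proof. by move=> AB [E [mE EA PE]]; exists E; split => //; exact: subset_trans AB. Qed.

Theorem theorem1 (R : realType) (p : nat) (hp : (0 < p)%N)
    (Sigma0 : 'M[R]_p) (hSigma0 : posdef Sigma0)
    (d : measure_display) (T : measurableType d) (P : probability T R)
    (X : forall n : nat, T -> 'M[R]_(n, p))
    (hX : forall n : nat, gaussian_sample P (X n) Sigma0)
    (pen : R -> R -> R) (hpen : forall lam : R, is_penalty (pen lam))
    (lam : nat -> R)
    (nu0 : 'rV[R]_(p * p)) (hnu0 : equiv_dags (invmx Sigma0) nu0)
    (hreg : forall i j : 'I_p, Phi_of nu0 i j != 0 ->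
       equi_C2_at (fun n => pen (lam n)) `|Phi_of nu0 i j|)
    (hb : b_seq (fun n => pen (lam n)) nu0 n @[n --> \oo] --> (0 : R)) :
  exists nuhat : nat -> T -> 'rV[R]_(p * p),
    whp P (fun n => [set w |
      local_maximizer (@dag_space R p)
        (penalized_loglik (pen (lam n)) (X n w)) (nuhat n w)])
    /\
    Op_bounded P (fun n w => enorm (nuhat n w - nu0))
      (fun n => (Num.sqrt n%:R)^-1 + a_seq (fun n => pen (lam n)) nu0 n).
Proof.
pose q n := pen (lam n).
pose rate n : R := (Num.sqrt n%:R)^-1 + a_seq q nu0 n.
have rate0 n : 0 <= rate n.
  by rewrite addr_ge0 ?invr_ge0 ?sqrtr_ge0//; exact: bigmax_ge_id.
(* The selection is made separately for each pair (n, w), so one estimator serves every confidence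
   level. *)
have [xhat xhatP] := @choose_at_rate (nat * T)%type 'rV[R]_(p * p) R
  (fun nw => local_maximizer (@dag_space R p)
    (penalized_loglik (q nw.1) (X nw.1 nw.2)))
  (fun x => enorm (x - nu0)) (fun nw => rate nw.1) nu0 (fun nw => rate0 nw.1).
have main eps : 0 < eps -> exists k : nat, \forall n \near \oo,
    inner_prob_ge P [set w |
      local_maximizer (@dag_space R p) (penalized_loglik (q n) (X n w))
        (xhat (n, w)) /\
      enorm (xhat (n, w) - nu0) <= k%:R * rate n] (1 - eps).
  move=> eps0; have [M M0 cov] := sample_covariance_whp hp hSigma0 hX eps0.
  have [C HC] := penalized_mle_exists hSigma0 hnu0 (fun n => hpen (lam n))
    hreg hb M0.
  (* The selection works with integer multiples of the rate, so [C] is rounded up. *)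
  exists (Num.truncn C).+1; near=> n.
  have : inner_prob_ge P [set w | forall j k,
      `|(n%:R^-1 *: ((X n w)^T *m X n w) - Sigma0) j k|
        <= M / Num.sqrt n%:R] (1 - eps) by near: n.
  apply: inner_prob_geS => w Sd; apply: (xhatP (n, w)).
  have Cn : forall Y : 'M[R]_(n, p),
    (forall j k, `|(n%:R^-1 *: (Y^T *m Y) - Sigma0) j k|
       <= M / Num.sqrt n%:R) ->
    exists2 nu, local_maximizer (@dag_space R p) (penalized_loglik (q n) Y) nu
      & enorm (nu - nu0) <= C * rate n by near: n.
  have [nu numax nuC] := Cn _ Sd; exists nu => //.
  by apply: le_trans nuC _; rewrite ler_wpM2r// ltW// truncnS_gt.
exists (fun n w => xhat (n, w)); split => eps eps0.
  have [k Hk] := main eps eps0; move: Hk; apply: filterS => n.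
  by apply: inner_prob_geS => w [].
have [k Hk] := main eps eps0; exists k%:R; move: Hk; apply: filterS => n.
apply: inner_prob_geS => w [_ le_rate] /=.
by rewrite ger0_norm// enorm_ge0.
Unshelve. all: by end_near. Qed.
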